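(* Let $G$ be a locally compact Polish group with left Haar measure $\mu$ and let $X$ be a separable metrizable space. Let $(X_t)_{t\in G}$ be a Haar measurable stationary stochastic field with values in $X$ (i.e. $X_t:\Omega\to X$ for each $t\in G$) on a standard (Lebesgue) probability space $(\Omega,\mathcal{F},\mathbb{P})$. Then the following alternative holds: either $(X_t)_{t\in G}$ is sample continuous, or for every non-null set $T\subset G$ the restricted field $(X_t)|_T$ does not have a natural modification.
   Context: The group $G$ is not assumed Abelian, but its operation is written additively. A set $T\subset G$ (not necessarily measurable) is non-null if its outer Haar measure is positive. $(X_t)|_T$ denotes $(X_t)_{t\in T}$, the restriction to the index set $T$. A modification of an $X$-valued field $(X_t)_{t\in T}$ on $\Omega$ is a map $\xi:\Omega\to X^T$ such that for each $t\in T$, $\xi(\omega)(t)=X_t(\omega)$ for almost every $\omega$. A modification $\xi$ is called natural if there exists a second countable topology $\mathcal{T}$ on the set $T$ such that for almost every $\omega\in\Omega$ the function $\xi(\omega):T\to X$ is $\mathcal{T}$-continuous. The field $(X_t)_{t\in G}$ is sample continuous if it has a modification $\xi$ such that for almost every $\omega$ the function $\xi(\omega):G\to X$ is continuous with respect to the given topology of $G$. The field is Haar measurable if it has a modification $f(\omega,t)$ that is jointly measurable on $\Omega\times G$ with respect to $\mathcal{F}\otimes\mathcal{B}$, where $\mathcal{B}$ is the $\sigma$-algebra of Haar measurable subsets of $G$. It is stationary if for all $s,t_1,\dots,t_n\in G$ the tuples $(X_{s+t_1},\dots,X_{s+t_n})$ and $(X_{t_1},\dots,X_{t_n})$ have the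 same distribution. *)

(* Defs.v *)
From HB Require Import structures.
From mathcomp Require Import all_boot all_order all_algebra.
From mathcomp Require Import all_classical all_reals all_analysis.

Set Implicit Arguments.
Unset Strict Implicit.
Unset Printing Implicit Defensive.

Import Order.TTheory GRing.Theory Num.Theory.

Local Open Scope classical_set_scope.
Local Open Scope ring_scope.

(* Groups are not assumed abelian, hence [groupType] with its multiplicative
   notation: the product [(s * t)%g] is the sum s + t of additive notation.
   The distinguished point of [PointedTopological] plays no role; it is there
   because measurable types are pointed. *)
HB.mixin Record isTopologicalGroup G of Group G & PointedTopological G := {
  mulg_continuous : continuous (fun x : G * G => (x.1 * x.2)%g);
  invg_continuous : continuous (fun x : G => x^-1%g)
}.

#[short(type="topologicalGroupType")]
HB.structure Definition TopologicalGroup :=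
  {G of Group G & PointedTopological G & isTopologicalGroup G}.

Notation borel T := (g_sigma_algebraType (@open T)).

Section topology.
Variable R : realType.

(* [m] is a metric structure on the bare type [T]; it comes with its own
   neighbourhoods, which are required to be those of the topology of [T]. *)
Definition metrizes (T : topologicalType) (m : Metric R T) :=
  forall x : T, @nbhs _ (Metric.Pack m) x = nbhs x.

Definition metrizable (T : topologicalType) :=
  exists m : Metric R T, metrizes m.

Definition complete_metric (M : metricType R) :=
  forall F : set_system M, ProperFilter F -> cauchy F ->
    exists l : M, F --> l.

Definition completely_metrizable (T : topologicalType) :=
  exists2 m : Metric R T, metrizes m & complete_metric (Metric.Pack m).

Definition separable (T : topologicalType) :=
  exists2 D : set T, countable D & dense D.

Definition polish (T : topologicalType) :=
  separable T /\ completely_metrizable T.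

End topology.

Section haar.
Local Open Scope ereal_scope.
Variables (R : realType) (G : topologicalGroupType).

(* A nonzero left-invariant Radon measure. *)
Definition left_haar (mu : {measure set (borel G) -> \bar R}) :=
  [/\ mu setT != 0,
      forall (g : G) (A : set (borel G)), measurable A ->
        mu [set (g * a)%g | a in A] = mu A,
      forall K : set G, compact K -> mu K < +oo,
      forall A : set (borel G), measurable A ->
        mu A = ereal_inf [set mu U | U in [set U | open U /\ A `<=` U]] &
      forall U : set G, open U ->
        mu U = ereal_sup [set mu K | K in [set K | compact K /\ K `<=` U]]].

End haar.

Section standard.
Local Open Scope ereal_scope.
Variable R : realType.

Definition isomorphic_mod0 d1 d2 (T1 : measurableType d1)
    (T2 : measurableType d2) (P : set T1 -> \bar R) (Q : set T2 -> \bar R) :=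
  exists (A1 : set T1) (A2 : set T2) (f : T1 -> T2) (g : T2 -> T1),
    [/\ [/\ measurable A1, P (~` A1) = 0, measurable A2 & Q (~` A2) = 0],
        [/\ set_fun A1 A2 f, set_fun A2 A1 g,
            {in A1, cancel f g} & {in A2, cancel g f}],
        measurable_fun A1 f, measurable_fun A2 g &
        forall B, measurable B -> P (A1 `&` f @^-1` B) = Q (A2 `&` B)].

(* Lebesgue measure on [0, a], together with atoms of mass w n at the points
   -(n+1) of the real line; a and the w n may be zero. *)
Definition interval_with_atoms (nu : {measure set (measurableTypeR R) -> \bar R})
    (a : R) (w : nat -> R) :=
  forall A : set (measurableTypeR R), measurable A ->
    nu A = lebesgue_measure (A `&` `[0%R, a]) +
           \sum_(0 <= n <oo) (w n)%:E * \d_(- n.+1%:R : R)%R A.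

(* Standard (Lebesgue-Rokhlin) probability space. *)
Definition standard d (T : measurableType d) (P : probability T R) :=
  measure_is_complete P /\
  exists (nu : {measure set (measurableTypeR R) -> \bar R}) (a : R)
      (w : nat -> R),
    [/\ (0 <= a)%R, forall n, (0 <= w n)%R, interval_with_atoms nu a w &
        isomorphic_mod0 P (@completed_measure_extension _ _ _ nu)].

End standard.

Section fields.
Local Open Scope ereal_scope.
Variables (R : realType) (d : measure_display) (Omega : measurableType d).
Variables (P : probability Omega R) (X : ptopologicalType).

(* A field indexed by a type I is a map I -> Omega -> X. *)
Definition stochastic_field (I : Type) (Y : I -> Omega -> X) :=
  forall t, measurable_fun setT (Y t : Omega -> borel X).

Definition modification (I : Type) (Y : I -> Omega -> X)
    (xi : Omega -> I -> X) :=
  forall t, {ae P, forall omega, xi omega t = Y t omega}.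

(* [c] is a topology on the bare index type I. *)
Definition natural (I : Type) (xi : Omega -> I -> X) :=
  exists2 c : Topological I,
    @second_countable (Topological.Pack c) &
    {ae P, forall omega, continuous (xi omega : Topological.Pack c -> X)}.

Definition has_natural_modification (I : Type) (Y : I -> Omega -> X) :=
  exists2 xi, modification Y xi & natural xi.

Definition restrict_field (I : Type) (T : set I) (Y : I -> Omega -> X) :
    set_type T -> Omega -> X :=
  fun t => Y (set_val t).

Definition sample_continuous (G : topologicalType) (Y : G -> Omega -> X) :=
  exists2 xi, modification Y xi & {ae P, forall omega, continuous (xi omega)}.

(* The Haar measurable subsets of G are the sets Caratheodory-measurable for
   the outer Haar measure [mu^*]. *)
Definition haar_measurable_field (G : topologicalGroupType)
    (mu : {measure set (borel G) -> \bar R}) (Y : G -> Omega -> X) :=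
  exists2 xi : Omega -> G -> X, modification Y xi &
    measurable_fun setT
      ((fun p => xi p.1 p.2) : Omega * caratheodory_type (mu^*)%mu -> borel X).

(* The sigma-algebra of n-tuples is the product one; it is the Borel
   sigma-algebra of X^n when X is separable metrizable. *)
Definition stationary (G : topologicalGroupType) (Y : G -> Omega -> X) :=
  forall (n : nat) (s : G) (t : n.-tuple G) (A : set (n.-tuple (borel X))),
    measurable A ->
    pushforward P (fun omega => [tuple Y (s * tnth t i)%g omega | i < n]
                     : n.-tuple (borel X)) A =
    pushforward P (fun omega => [tuple Y (tnth t i) omega | i < n]
                     : n.-tuple (borel X)) A.

End fields.

(* Main.v *)
(** Let the restriction of Y to a non-null T have a natural modification z. The
    second countable topology on T provides countably many sets W_J and points
    s_J of W_J such that, for almost every omega, the values Y_(s_J)(omega)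
    alone determine the continuous path z(omega) on T; call such a sequence of
    values "good". T is covered by countably many small balls of the
    left-invariant distance in probability, so by Haar measurability and
    Steinhaus' theorem Y is continuous in probability.

    Since Omega is a standard space, goodness of a sequence follows, up to
    probability epsilon, from its finite parts (a compactness argument), hence
    it is invariant under translations: for almost every omega, for almost every
    g, the sequence (Y_(g s_J)(omega))_J is good. Now fix such an omega and any
    x in G. The set x T^-1 is non-null, and g in x T^-1 means that g^-1 x is in
    T; so some non-null measurable set A of elements g satisfies x in g cl(W_J)
    while all Y_(g s) with s in W_J are delta-close to one point. By Steinhaus'
    theorem, every y near x lies in some g cl(W_J) with g in A, whence Y_y is
    close to that point too. So Y, restricted to a countable dense set, has a
    limit in X at every x of G, and these limits form the continuous
    modification. *)
From HB Require Import structures.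
Require Import Defs.
From mathcomp Require Import all_boot all_order all_algebra.
From mathcomp Require Import all_classical all_reals all_analysis.
From mathcomp Require Import measurable_realfun lra.

Set Implicit Arguments.
Unset Strict Implicit.
Unset Printing Implicit Defensive.

Import Order.TTheory GRing.Theory Num.Theory.
Import numFieldNormedType.Exports.

Local Open Scope classical_set_scope.
Local Open Scope ring_scope.
Local Open Scope ereal_scope.

(** * Fubini for null sets, and outer measures *)

Section sigma_finite_pack.
Context d (T : measurableType d) (R : realType) (m : {measure set T -> \bar R}).
Hypothesis sfm : sigma_finite setT m.

(* The hypothesis is an argument so that the instances below can be inferred
   from the term alone. *)
Definition sigma_finite_pack of sigma_finite setT m := m : set T -> \bar R.
HB.instance Definition _ := Measure.on (sigma_finite_pack sfm).
HB.instance Definition _ :=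
  Measure_isSigmaFinite.Build _ _ _ (sigma_finite_pack sfm) sfm.
End sigma_finite_pack.

(** Both iterated integrals of the indicator of [E] give its product measure, and a nonnegative
    function with integral zero vanishes almost everywhere. *)
Lemma fubini_null d1 d2 (T1 : measurableType d1) (T2 : measurableType d2)
    (R : realType) (m1 : {measure set T1 -> \bar R})
    (m2 : {measure set T2 -> \bar R}) (E : set (T1 * T2)) :
  sigma_finite setT m1 -> sigma_finite setT m2 ->
  measurable E -> (forall y, m1 (ysection E y) = 0) ->
  \forall x \ae m1, m2 (xsection E x) = 0.
Proof.
move=> sf1 sf2 mE E0.
pose M1 : {sigma_finite_measure set T1 -> \bar R} := sigma_finite_pack sf1.
pose M2 : {sigma_finite_measure set T2 -> \bar R} := sigma_finite_pack sf2.
have mf := measurable_fun_xsection M2 mE.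
have /(ae_eq_integral_abs M1 measurableT mf).1 : \int[M1]_x `|(M2 \o xsection E) x| = 0.
  have -> : \int[M1]_x `|(M2 \o xsection E) x| = (M1 \x M2) E.
    by apply: eq_integral => x _; rewrite gee0_abs//=.
  have -> := @product_measure_unique _ _ _ _ _ M1 M2 (M1 \x^ M2) _ _ mE.
    by rewrite /= /product_measure2 integral0_eq// => y _; exact: E0.
  by move=> A B mA mB; exact: product_measure2E.
by apply: filterS => x /(_ I).
Qed.

Lemma outer_null_bigcup (T : Type) (R : realType)
    (nu : {outer_measure set T -> \bar R}) (I : countType) (F : I -> set T) :
  (forall i, nu (F i) = 0) -> nu (\bigcup_i F i) = 0.
Proof.
move=> F0; apply/eqP; rewrite eq_le outer_measure_ge0 andbT.
pose F' n := if @unpickle I n is Some i then F i else set0.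
apply: (@le_trans _ _ (nu (\bigcup_n F' n))).
  apply: le_outer_measure => x [i _ Fix]; exists (pickle i) => //.
  by rewrite /F' pickleK.
apply: (le_trans (outer_measure_sigma_subadditive nu F')).
rewrite eseries0// => n _ _; rewrite /F'; case: unpickle => [i|]//.
Qed.

Lemma outer_nullU (T : Type) (R : realType)
    (nu : {outer_measure set T -> \bar R}) (A B : set T) :
  nu A = 0 -> nu B = 0 -> nu (A `|` B) = 0.
Proof.
move=> A0 B0; apply/eqP; rewrite eq_le outer_measure_ge0 andbT.
by apply: (le_trans (outer_measureU2 nu A B)); rewrite A0 B0 adde0.
Qed.

Lemma outer_nullS (T : Type) (R : realType)
    (nu : {outer_measure set T -> \bar R}) (A B : set T) :
  A `<=` B -> nu B = 0 -> nu A = 0.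
Proof.
move=> AB B0; apply/eqP; rewrite eq_le outer_measure_ge0 andbT -B0.
exact: le_outer_measure.
Qed.

Lemma outer_null_caratheodory (T : Type) (R : realType)
    (nu : {outer_measure set T -> \bar R}) (A : set T) :
  nu A = 0 -> nu.-caratheodory A.
Proof.
move=> A0; apply: le_caratheodory_measurable => X.
rewrite (outer_nullS _ A0) ?add0e; last exact: subIsetr.
by apply: le_outer_measure; exact: subIsetl.
Qed.

Lemma outer_hull_le d (T : measurableType d) (R : realType)
    (mu : {measure set T -> \bar R}) (A : set T) (e : R) :
  (0 < e)%R -> (mu^*)%mu A < +oo ->
  exists M, [/\ measurable M, A `<=` M & mu M <= (mu^*)%mu A + e%:E].
Proof.
move=> e0 fA.
have /(lb_ereal_inf_adherent e0) : (mu^*)%mu A \is a fin_num.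
  by rewrite ge0_fin_numE// outer_measure_ge0.
move=> [_ [F [mF AF] <-]] /ltW lt.
exists (\bigcup_n F n); split => //; first exact: bigcupT_measurable.
by apply: le_trans lt; apply: measure_sigma_subadditive => //; exact: bigcupT_measurable.
Qed.

(** Measurable supersets of excess at most [n.+1%:R^-1] are intersected; if the outer measure is
    infinite, the whole space serves. *)
Lemma outer_hull d (T : measurableType d) (R : realType)
    (mu : {measure set T -> \bar R}) (A : set T) :
  exists M, [/\ measurable M, A `<=` M & mu M = (mu^*)%mu A].
Proof.
have [fA|] := ltP ((mu^*)%mu A) +oo; last first.
  rewrite leye_eq => /eqP Aoo; exists setT; split => //.
  apply/eqP; rewrite Aoo -leye_eq -Aoo -measurable_mu_extE//.
  exact: le_outer_measure.
have /choice[M hM] n : exists M, [/\ measurable M, A `<=` M &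
    mu M <= (mu^*)%mu A + (n.+1%:R^-1)%:E].
  by apply: outer_hull_le.
exists (\bigcap_n M n).
have mM : measurable (\bigcap_n M n) by apply: bigcapT_measurable => n; case: (hM n).
have AM : A `<=` \bigcap_n M n by move=> x Ax n _; case: (hM n) => _ + _; apply.
split => //; apply/eqP; rewrite eq_le; apply/andP; split; last first.
  by rewrite -measurable_mu_extE//; exact: le_outer_measure.
apply/lee_addgt0Pr => e e0.
have [n ne] : exists n : nat, (n.+1%:R^-1 < e :> R)%R.
  exists (Num.truncn e^-1); rewrite invf_plt ?posrE//.
  exact: truncnS_gt.
have [mMn _ hn] := hM n.
apply: (@le_trans _ _ (mu (M n))).
  by apply: le_measure; rewrite ?inE//; apply: bigcap_inf.
apply: (le_trans hn); rewrite leeD2l// lee_fin; exact: ltW.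
Qed.

(** * Compatible metrics, dense sequences and countable bases *)

Section metric.
Variable R : realType.

(** The metric is a plain function on [T], which keeps its own topology, whereas [metrizable] puts a
    second structure on the bare type. *)
Record metric_for (T : topologicalType) (rho : T -> T -> R) : Prop := MetricFor {
  rho_ge0 : forall x y, (0 <= rho x y)%R ;
  rho_refl : forall x, rho x x = 0%R ;
  rho_sep : forall x y, rho x y = 0%R -> x = y ;
  rho_sym : forall x y, rho x y = rho y x ;
  rho_tri : forall x y z, (rho x z <= rho x y + rho y z)%R ;
  rho_nbhs : forall x (A : set T), nbhs x A <->
    exists2 e : R, (0 < e)%R & forall y, (rho x y < e)%R -> A y }.

Lemma metrizable_metric_for (T : topologicalType) :
  metrizable R T -> exists rho : T -> T -> R, metric_for rho.
Proof.
move=> [m mE]; exists (@mdist R (Metric.Pack m)); split.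
- exact: (@mdist_ge0 R (Metric.Pack m)).
- exact: (@mdistxx R (Metric.Pack m)).
- exact: (@mdist_positivity R (Metric.Pack m)).
- exact: (@metric_sym R (Metric.Pack m)).
- by move=> x y z; exact: (@metric_triangle R (Metric.Pack m)).
- move=> x A; rewrite -mE -(@metricType_numDomainType.filter_from_mdist_nbhs R (Metric.Pack m)).
  by split=> -[e e0 h]; exists e => //.
Qed.

Variables (T : topologicalType) (rho : T -> T -> R) (hrho : metric_for rho).

Lemma nbhs_rho (x : T) (e : R) : (0 < e)%R -> nbhs x [set y | rho x y < e]%R.
Proof. by move=> e0; apply/(rho_nbhs hrho); exists e. Qed.

Lemma open_rho (x : T) (e : R) : open [set y | rho x y < e]%R.
Proof.
rewrite openE => y /= xye; apply/(rho_nbhs hrho); exists (e - rho x y)%R.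
  by rewrite subr_gt0.
move=> z yz /=; apply: (le_lt_trans (rho_tri hrho x y z)).
by rewrite -ltrBrDl.
Qed.

Lemma metric_for_hausdorff : hausdorff_space T.
Proof.
move=> x y xy; apply: (rho_sep hrho); apply/eqP; apply/negPn/negP => xy0.
have d0 : (0 < rho x y)%R by rewrite lt0r xy0 (rho_ge0 hrho).
have d2 : (0 < rho x y / 2)%R by rewrite divr_gt0.
have [z [/= xz yz]] := xy _ _ (nbhs_rho x d2) (nbhs_rho y d2).
have := rho_tri hrho x z y; rewrite leNgt (rho_sym hrho z) => /negP; apply.
by rewrite [ltRHS]splitr ltrD.
Qed.

Lemma metric_continuous (S : topologicalType) (f : S -> T) (x : S) :
  (forall e : R, (0 < e)%R -> \forall y \near x, (rho (f x) (f y) <= e)%R) ->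
  {for x, continuous f}.
Proof.
move=> h A /(rho_nbhs hrho)[e e0 eA].
have e2 : (0 < e / 2)%R by rewrite divr_gt0.
have := h _ e2; apply: filterS => y hy; apply: eA; apply: (le_lt_trans hy).
by rewrite gtr_pMr// invf_lt1 ?ltr1n.
Qed.

End metric.

Section separability.
Variables (R : realType) (T : ptopologicalType) (rho : T -> T -> R).
Hypotheses (hrho : metric_for rho) (sT : separable T).

Lemma dense_sequence : exists u : nat -> T,
  forall U : set T, open U -> U !=set0 -> exists n, U (u n).
Proof.
have [D cD dD] := sT; have [x0 Dx0] : D !=set0.
  by have [x [_ Dx]] := dD setT (ex_intro _ point I) openT; exists x.
have /countable_injP[f finj] := cD.
exists (fun n => xget x0 [set x | D x /\ f x = n]) => U oU /dD/(_ oU)[x [Ux Dx]].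
exists (f x); case: xgetP => [y _ [Dy fyx]|/(_ x)]; last by case.
by rewrite (finj _ _ _ _ fyx)// inE.
Qed.

Lemma rho_dense_sequence : exists u : nat -> T,
  forall x (e : R), (0 < e)%R -> exists n, (rho x (u n) < e)%R.
Proof.
have [u hu] := dense_sequence; exists u => x e e0.
apply: (hu [set y | rho x y < e]%R); first exact: open_rho.
by exists x => /=; rewrite (rho_refl hrho).
Qed.

Lemma countable_base : exists b : nat -> set T, (forall n, open (b n)) /\
  forall x (A : set T), nbhs x A -> exists n, b n x /\ b n `<=` A.
Proof.
have [u hu] := rho_dense_sequence.
pose F (p : nat * nat) := [set y | rho (u p.1) y < p.2.+1%:R^-1]%R.
exists (fun n => if @unpickle (nat * nat)%type n is Some p then F p else set0).
split=> [n|x A /(rho_nbhs hrho)[e e0 eA]].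
  by case: unpickle => [p|]; [exact: open_rho|exact: open0].
have [k ke] : exists k : nat, (k.+1%:R^-1 < e / 2 :> R)%R.
  exists (Num.truncn (e / 2)^-1); rewrite invf_plt ?posrE ?divr_gt0//.
  exact: truncnS_gt.
have k0 : (0 < k.+1%:R^-1 :> R)%R by [].
have [n xn] := hu x _ k0.
exists (pickle (n, k)); rewrite pickleK /F /=; split.
  by rewrite (rho_sym hrho).
move=> y /= ny; apply: eA; apply: (le_lt_trans (rho_tri hrho x (u n) y)).
by rewrite [ltRHS]splitr ltrD// (lt_trans _ ke).
Qed.

End separability.

Lemma continuous_borel (S T : ptopologicalType) (f : S -> T) :
  continuous f -> measurable_fun setT (f : borel S -> borel T).
Proof.
move=> cf; apply: (@measurability _ _ (borel S) (borel T) setT f (@open T)) => //.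
move=> _ [U oU <-]; rewrite setTI; apply: sub_sigma_algebra.
by move/continuousP : cf; apply.
Qed.

(** * Haar null sets, inner regularity and Steinhaus' theorem *)

Section haar_facts.
Variables (R : realType) (G : topologicalGroupType).
Variable mu : {measure set (borel G) -> \bar R}.
Hypothesis lcG : locally_compact [set: G].
Hypothesis polG : polish R G.
Hypothesis haar : left_haar mu.

Local Notation mus := (mu^*)%mu.

Let rhoG : exists rho : G -> G -> R, metric_for rho.
Proof. by apply: metrizable_metric_for; have [_ [m mm _]] := polG; exists m. Qed.

Let hausG : hausdorff_space G.
Proof. by have [rho hrho] := rhoG; exact: metric_for_hausdorff hrho. Qed.

Lemma group_countable_base : exists b : nat -> set G, (forall n, open (b n)) /\
  forall x (A : set G), nbhs x A -> exists n, b n x /\ b n `<=` A.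
Proof. by have [rho hrho] := rhoG; apply: (countable_base hrho); have [] := polG. Qed.

Lemma mulg_l_continuous (g : G) : continuous (fun x : G => (g * x)%g).
Proof.
move=> x; apply: (@continuous_comp _ _ _ (fun x => (g, x)) (fun p : G * G => (p.1 * p.2)%g)).
  by apply: cvg_pair => /=; [exact: cvg_cst|exact: cvg_id].
exact: mulg_continuous.
Qed.

Lemma mulg_r_continuous (g : G) : continuous (fun x : G => (x * g)%g).
Proof.
move=> x; apply: (@continuous_comp _ _ _ (fun x => (x, g)) (fun p : G * G => (p.1 * p.2)%g)).
  by apply: cvg_pair => /=; [exact: cvg_id|exact: cvg_cst].
exact: mulg_continuous.
Qed.

Lemma open_borel (U : set G) : open U -> measurable (U : set (borel G)).
Proof. exact: sub_sigma_algebra. Qed.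

Lemma closed_borel (U : set G) : closed U -> measurable (U : set (borel G)).
Proof.
by move=> cU; rewrite -(setCK U); apply: measurableC; apply: open_borel; exact: closed_openC.
Qed.

Lemma compact_borel (K : set G) : compact K -> measurable (K : set (borel G)).
Proof. by move=> cK; apply: closed_borel; exact: compact_closed. Qed.

Lemma preimage_borel (f : G -> G) (A : set G) : continuous f ->
  measurable (A : set (borel G)) -> measurable (f @^-1` A : set (borel G)).
Proof. by move=> cf mA; rewrite -[X in measurable X]setTI; exact: continuous_borel. Qed.

(** By local compactness the basic open sets that lie in some compact set cover [G]; one compact
    superset is chosen for each. *)
Lemma compact_sequence : exists K : nat -> set G,
  (forall n, compact (K n)) /\ forall x, exists n, K n x.
Proof.
have [b [bo bb]] := group_countable_base.
have /choice[K hK] n : exists K : set G, compact K /\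
    ((exists2 C, compact C & b n `<=` C) -> b n `<=` K).
  have [[C cC bC]|nC] := pselect (exists2 C, compact C & b n `<=` C).
    by exists C.
  by exists set0; split => //; exact: compact0.
exists K; split=> [n|x]; first by case: (hK n).
have [U xU [cU _]] := lcG (I : [set: G] x).
have [n [bnx bnU]] : exists n, b n x /\ b n `<=` U.
  by apply: bb; apply: (@filterS _ (nbhs x) _ [set y | [set: G] y -> U y] U) xU => y /(_ I).
by exists n; case: (hK n) => _; apply => //; exists U.
Qed.

Lemma haar_compact (K : set G) : compact K -> mu K < +oo.
Proof. by move: K; case: haar. Qed.

Lemma haar_sigma_finite : sigma_finite setT mu.
Proof.
have [K [cK KT]] := compact_sequence.
exists K; last first.
  by move=> n; split; [exact: compact_borel|exact: haar_compact].
by apply/seteqP; split => // x _; have [n ?] := KT x; exists n.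
Qed.

Lemma haar_translate (g : G) (A : set G) : measurable (A : set (borel G)) ->
  mu [set x | A (g^-1 * x)%g] = mu A.
Proof.
move=> mA; have [_ + _ _ _] := haar => /(_ g A mA) <-; congr (mu _).
apply/seteqP; split => [x /= Ax|_ [a Aa <-] /=]; last by rewrite mulKg.
by exists (g^-1 * x)%g => //; rewrite mulVKg.
Qed.

Let outer_translate_le (g : G) (A : set G) : mus [set x | A (g^-1 * x)%g] <= mus A.
Proof.
have [M [mM AM <-]] := outer_hull mu A.
rewrite -(haar_translate g mM) -measurable_mu_extE; last first.
  by apply: preimage_borel => //; exact: mulg_l_continuous.
by apply: le_outer_measure => x /=; exact: AM.
Qed.

Lemma outer_translate (g : G) (A : set G) : mus [set x | A (g^-1 * x)%g] = mus A.
Proof.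
apply/eqP; rewrite eq_le outer_translate_le/=.
have := outer_translate_le g^-1%g [set x | A (g^-1 * x)%g].
set B := (X in X <= _ -> _); have -> // : B = mus A.
by congr (mus _); apply/seteqP; split => x /=; rewrite invgK mulKg.
Qed.

Lemma outer_open (A : set G) (e : R) : (0 < e)%R -> mus A < +oo ->
  exists U, [/\ open U, A `<=` U & mu U <= mus A + e%:E].
Proof.
move=> e0 fA; have [M [mM AM muM]] := outer_hull mu A.
have [_ _ _ /(_ M mM) outM _] := haar.
have := fA; rewrite -muM => fM.
have : mu M \is a fin_num by rewrite ge0_fin_numE.
rewrite [X in X \is a fin_num]outM => /(lb_ereal_inf_adherent e0)[_ [U [oU MU] <-]].
rewrite -outM => /ltW lt; exists U; split => //.
exact: subset_trans MU.
Qed.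

(** Removing from a compact [K n] an open set that tightly covers the part of [K n] outside [A]
    leaves a compact subset of [A]. *)
Lemma caratheodory_compact (A : set G) : mus.-caratheodory A -> 0 < mus A ->
  exists K, [/\ compact K, K `<=` A & 0 < mu K].
Proof.
move=> cA A0; have [K [cK KT]] := compact_sequence.
have [n An] : exists n, 0 < mus (A `&` K n).
  apply: contrapT => h; move: A0; apply/negP; rewrite -leNgt.
  suff -> : mus A = 0 by [].
  apply: (@outer_nullS (borel G) _ _ _ (\bigcup_n (A `&` K n))).
    by move=> x Ax; have [n Kx] := KT x; exists n.
  apply: outer_null_bigcup => n; apply/eqP; rewrite eq_le outer_measure_ge0 andbT.
  by rewrite leNgt; apply/negP => ?; apply: h; exists n.
have mK := compact_borel (cK n).
have fK := haar_compact (cK n).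
have := fK; rewrite -measurable_mu_extE// => fK'.
have fAK : mus (A `&` K n) \is a fin_num.
  by rewrite ge0_fin_numE ?outer_measure_ge0// (le_lt_trans _ fK')// le_outer_measure.
have fKA : mus (K n `&` ~` A) < +oo.
  by apply: le_lt_trans fK'; exact: le_outer_measure.
set a := fine (mus (A `&` K n)).
have a0 : (0 < a)%R by rewrite fine_gt0// An -ge0_fin_numE// ltW.
have a2 : (0 < a / 2)%R by rewrite divr_gt0.
have [W [oW KW muW]] := outer_open a2 fKA.
exists (K n `\` W); split.
- apply: (subclosed_compact _ (cK n)); last exact: subIsetl.
  rewrite setDE.
  by apply: closedI; [exact: compact_closed|exact: open_closedC].
- by move=> x [Kx Wx]; apply: contrapT => Ax; apply: Wx; exact: KW.
- have mW := open_borel oW.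
  (* If the difference were null, the excess [a / 2] of [W] would have to account for all of [A]
     within [K n], which has measure [a]. *)
  rewrite lt0e measure_ge0 andbT; apply/negP => /eqP h0.
  have : mu (K n) <= mu W.
    have -> : mu (K n) = mu (K n `\` W) + mu (K n `&` W) := measureDI mu mK mW.
    rewrite h0 add0e.
    by apply: le_measure; rewrite ?inE//; exact: measurableI.
  have <- : mus (K n) = mu (K n) := measurable_mu_extE mu mK.
  rewrite (cA (K n)) => /le_trans/(_ muW).
  rewrite addeC leeD2lE; last by rewrite ge0_fin_numE// outer_measure_ge0.
  rewrite setIC -(fineK fAK) -/a lee_fin leNgt => /negP; apply.
  by rewrite gtr_pMr// invf_lt1 ?ltr1n.
Qed.

(** A compact [K] in [A] has an open superset [U] of measure at most 3/2 that of [K]. For [v] near 1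
    both [K] and [vK] lie in [U]; a null intersection would give their union twice the measure of
    [K]. *)
Lemma steinhaus (A : set G) : mus.-caratheodory A -> 0 < mus A ->
  \forall v \near (1%g : G), 0 < mus (A `&` [set x | A (v^-1 * x)%g]).
Proof.
move=> cA A0; have [K [cK KA K0]] := caratheodory_compact cA A0.
have mK := compact_borel cK.
have fK := haar_compact cK.
have fK' : mus K < +oo by rewrite measurable_mu_extE.
set a := fine (mu K).
have aE : mu K = a%:E by rewrite fineK// ge0_fin_numE.
have a0 : (0 < a)%R by rewrite -lte_fin -aE.
have a2 : (0 < a / 2)%R by rewrite divr_gt0.
have [U [oU KU]] := outer_open a2 fK'; rewrite measurable_mu_extE// aE => muU.
have mU := open_borel oU.
(* Continuity of multiplication at the points [(1, x)] is made uniform over the compact [K]. *)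
have : \forall v \near (1%g : G), K `<=` [set x | U (v * x)%g].
  move/compact_near_coveringP : cK => /(_ _ (nbhs (1%g : G)) (fun v x => U (v * x)%g)).
  apply => x Kx.
  have : nbhs (1 * x)%g U by rewrite mul1g; apply: open_nbhs_nbhs; split => //; exact: KU.
  move=> /(@mulg_continuous G (1%g, x)) [[P Q] /= [P1 Qx] PQ].
  by exists (Q, P) => //= -[y v] [/= Qy Pv]; exact: (PQ (v, y)).
apply: filterS => v KvU.
set vK := [set x | K (v^-1 * x)%g].
have mvK : measurable (vK : set (borel G)).
  by apply: preimage_borel => //; exact: mulg_l_continuous.
have vKU : vK `<=` U by move=> x /KvU /=; rewrite mulVKg.
rewrite lt_neqAle outer_measure_ge0 andbT eq_sym; apply/negP => /eqP h.
have I0 : mu (vK `&` K) = 0.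
  rewrite -measurable_mu_extE; last exact: measurableI.
  by apply: outer_nullS h => x [vx Kx]; split; exact: KA.
have D : mu (vK `\` K) = a%:E.
  have E : mu vK = mu (vK `\` K) + mu (vK `&` K) := measureDI mu mvK mK.
  by rewrite I0 adde0 in E; rewrite -E -aE -(haar_translate v mK).
have : mu (K `|` (vK `\` K)) <= (a + a / 2)%:E.
  apply: le_trans muU; apply: le_measure; rewrite ?inE//.
    by apply: measurableU => //; exact: measurableD.
  by move=> x [/KU//|[/vKU]].
have -> : mu (K `|` (vK `\` K)) = mu K + mu (vK `\` K).
  rewrite measureU//; first exact: measurableD.
  by rewrite setDE setICA setICr setI0.
rewrite D aE -EFinD lee_fin lerD2l leNgt => /negP; apply.
by rewrite gtr_pMr// invf_lt1 ?ltr1n.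
Qed.

Lemma borel_caratheodory (A : set G) :
  measurable (A : set (borel G)) -> mus.-caratheodory A.
Proof. exact: caratheodory_measurable_mu_ext. Qed.

(** A countable base makes every open subset of [G * G] a countable union of open boxes, hence
    measurable for the product sigma-algebra. *)
Lemma continuous2_borel (f : G * G -> G) : continuous f ->
  measurable_fun setT (f : borel G * borel G -> borel G).
Proof.
move=> cf; have [b [bo bb]] := group_countable_base.
apply: (@measurability _ _ (borel G * borel G)%type (borel G) setT f (@open G)) => //.
move=> _ [U oU <-]; rewrite setTI.
pose F (p : nat * nat) : set (borel G * borel G) :=
  if pselect (b p.1 `*` b p.2 `<=` f @^-1` U) then b p.1 `*` b p.2 else set0.
have -> : f @^-1` U = \bigcup_p F p.
  apply/seteqP; split => [[x y] Uxy|[x y] [p _]]; last first.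
    by rewrite /F; case: pselect => //= h bxy; exact: (h (x, y)).
  have nU : nbhs (f (x, y)) U by exact: open_nbhs_nbhs.
  have [[A B] /= [Ax By] ABU] := cf (x, y) U nU.
  have [n [bnx bnA]] := bb _ _ Ax; have [m [bmy bmB]] := bb _ _ By.
  exists (n, m) => //; rewrite /F; case: pselect => //= -[] [u v] [/= bu bv].
  by apply: (ABU (u, v)); split; [exact: bnA|exact: bmB].
have mF p : measurable (F p).
  by rewrite /F; case: pselect => //= _; apply: measurableX; exact: open_borel.
exact: (@countable_bigcupT_measurable _ (borel G * borel G)%type _ F).
Qed.

(* Fubini for {(x, y) | y^-1 x in N}: the sections at fixed y are left translates
   of N, those at fixed x are left translates of N^-1. *)
Let outer_null_inv_borel (N : set G) : measurable (N : set (borel G)) ->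
  mu N = 0 -> mu [set x | N x^-1%g] = 0.
Proof.
move=> mN N0.
pose f (p : G * G) := (p.2^-1 * p.1)%g.
have cf : continuous f.
  move=> p; apply: (@continuous_comp _ _ _ (fun p => (p.2^-1%g, p.1))
    (fun p : G * G => (p.1 * p.2)%g)); last exact: mulg_continuous.
  apply: cvg_pair => /=; last exact: cvg_fst.
  by apply: (@continuous_comp _ _ _ snd (fun x : G => x^-1%g)); [exact: cvg_snd|exact: invg_continuous].
have mE : measurable (f @^-1` N : set (borel G * borel G)).
  by rewrite -[X in measurable X]setTI; exact: continuous2_borel.
have sf := haar_sigma_finite.
have : \forall x \ae mu, mu (xsection (f @^-1` N) x) = 0.
  apply: (fubini_null sf sf mE) => y.
  rewrite -N0 -(haar_translate y mN); congr (mu _).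
  by apply/seteqP; split => x; rewrite /ysection/= inE.
move=> [Z [mZ Z0 hZ]].
have [x Zx] : exists x, ~ Z x.
  apply: contrapT => /forallNP h; have [+ _ _ _ _] := haar => /eqP; apply.
  by rewrite -Z0; congr (mu _); apply/seteqP; split => x // _; exact: contrapT.
have : mu (xsection (f @^-1` N) x) = 0 by apply: contrapT => h; apply: Zx; exact: hZ.
have -> : xsection (f @^-1` N) x = [set y | [set z | N z^-1%g] (x^-1 * y)%g].
  apply/seteqP; split => y; rewrite /xsection/= inE /f/= invgM invgK//.
by rewrite haar_translate//; apply: preimage_borel => //; exact: invg_continuous.
Qed.

Lemma outer_null_inv (A : set G) : mus A = 0 -> mus [set x | A x^-1%g] = 0.
Proof.
move=> A0; have [M [mM AM muM]] := outer_hull mu A.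
have mM' : measurable ([set x | M x^-1%g] : set (borel G)).
  by apply: preimage_borel => //; exact: invg_continuous.
apply: (@outer_nullS (borel G) _ _ _ [set x | M x^-1%g]) => [x|]; first exact: AM.
apply: etrans (measurable_mu_extE mu mM') _.
by apply: outer_null_inv_borel => //; rewrite muM.
Qed.

(** Right translation is inversion, left translation and inversion again, and each of these
    preserves null sets. *)
Lemma outer_null_rtranslate (A : set G) (s : G) :
  mus A = 0 -> mus [set x | A (x * s)%g] = 0.
Proof.
move=> A0; have := outer_null_inv A0.
rewrite -(outer_translate s) => /outer_null_inv.
by apply: etrans; congr (mus _); apply/seteqP; split => x /=; rewrite invgM !invgK.
Qed.

(* Only left translations preserve [mu]: a Caratheodory set is cut into a Borel
   set minus a null set, and right translations preserve null sets. *)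
Lemma caratheodory_rtranslate (A : set G) (s : G) :
  mus.-caratheodory A -> mus.-caratheodory [set x | A (x * s)%g].
Proof.
move=> cA; have [K [cK KT]] := compact_sequence.
have -> : [set x | A (x * s)%g] = \bigcup_n [set x | (A `&` K n) (x * s)%g].
  apply/seteqP; split => [x /= Ax|x [n _ []]//].
  by have [n Kx] := KT (x * s)%g; exists n.
apply: caratheodory_measurable_bigcup => n.
have [M [mM AM muM]] := outer_hull mu (A `&` K n).
have mK := compact_borel (cK n).
have cAK : mus.-caratheodory (A `&` K n).
  apply: caratheodory_measurable_setI => //; exact: borel_caratheodory.
have fAK : mus (A `&` K n) \is a fin_num.
  rewrite ge0_fin_numE ?outer_measure_ge0//.
  apply: (@le_lt_trans _ _ (mus (K n))); first exact: le_outer_measure.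
  have -> : mus (K n) = mu (K n) := measurable_mu_extE mu mK.
  exact: haar_compact.
have N0 : mus (M `&` ~` (A `&` K n)) = 0.
  have : mus M = mus (A `&` K n) by rewrite -muM; exact: measurable_mu_extE.
  rewrite (cAK M) (setIidr AM) => E.
  by rewrite -[LHS](addeK _ fAK) [X in X - _]addeC E subee.
have -> : [set x | (A `&` K n) (x * s)%g] =
    [set x | M (x * s)%g] `\` [set x | (M `&` ~` (A `&` K n)) (x * s)%g].
  apply/seteqP; split => [x /= AKx|x /= [Mx NM]].
    by split; [exact: AM|move=> [_ /(_ AKx)]].
  by apply: contrapT => h; apply: NM.
apply: caratheodory_measurable_setD; last first.
  by apply: outer_null_caratheodory; exact: outer_null_rtranslate.
apply: borel_caratheodory.
by apply: (preimage_borel _ mM); exact: mulg_r_continuous.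
Qed.

End haar_facts.

(** * Compact approximation in standard probability spaces *)

Section standard_space.
Variable R : realType.

(** Regularity of Lebesgue measure costs [e / 2]. The weights are summable, so finitely many atoms,
    which form a compact set, leave a tail of weight below [e / 2]. *)
Lemma interval_with_atoms_inner
    (nu : {measure set (measurableTypeR R) -> \bar R}) (a : R) (w : nat -> R)
    (A : set R) (e : R) :
  (forall n, 0 <= w n)%R -> interval_with_atoms nu a w -> nu setT < +oo ->
  measurable (A : set (measurableTypeR R)) -> (0 < e)%R ->
  exists K : set R, [/\ compact K, K `<=` A & nu (A `\` K) <= e%:E].
Proof.
move=> w0 nuE nufin mA e0.
have e2 : (0 < e / 2)%R by rewrite divr_gt0.
have mI : measurable (`[0%R, a]%classic : set (measurableTypeR R)) by exact: measurable_itv.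
have mAI : measurable (A `&` `[0%R, a] : set (measurableTypeR R)) by exact: measurableI.
have fAI : lebesgue_measure (A `&` `[0%R, a]) < +oo.
  apply: (@le_lt_trans _ _ (lebesgue_measure `[0%R, a]%classic)).
    by apply: le_measure; rewrite ?inE.
  by rewrite lebesgue_measure_itv/=; case: ifPn; rewrite ?ltry.
have [K1 [cK1 K1A K1e]] := lebesgue_regularity_inner mAI fAI e2.
pose x_ n : R := (- n.+1%:R)%R.
have wfin : \sum_(0 <= n <oo) (w n)%:E < +oo.
  apply: le_lt_trans nufin; rewrite nuE//.
  rewrite -[leLHS]add0e leeD//; apply: lee_nneseries => n _; first by rewrite lee_fin.
  by rewrite diracT mule1.
have wt : \sum_(N <= n <oo) (w n)%:E @[N --> \oo] --> 0%E.
  by apply: nneseries_tail_cvg => // n _; rewrite lee_fin.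
have [N wN] : exists N, \sum_(N <= n <oo) (w n)%:E < (e / 2)%:E.
  move: wt => /(_ [set x | x < (e / 2)%:E]) [|N _ hN].
    exact: (open_nbhs_nbhs (conj (@open_ereal_lt_ereal R (e / 2)%:E) _)).
  by exists N; apply: hN => /=.
pose K2 : set R := A `&` [set x_ n | n in `I_N].
have cK2 : compact K2.
  by apply: finite_compact; apply: sub_finite_set (finite_image _ (finite_II N)); exact: subIsetr.
exists (K1 `|` K2); split.
- exact: compactU.
- by move=> x [/K1A[]//|[]].
have mK : measurable (K1 `|` K2 : set (measurableTypeR R)).
  by apply: compact_measurable; exact: compactU.
have mK1 : measurable (K1 : set (measurableTypeR R)). by exact: compact_measurable.
rewrite nuE; last exact: measurableD.
rewrite [e]splitr EFinD leeD//.
  apply: le_trans (ltW K1e); apply: le_measure; rewrite ?inE.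
  - by apply: measurableI => //; exact: measurableD.
  - exact: measurableD.
  - by move=> x [[Ax nK] Ix]; split => // K1x; apply: nK; left.
apply: le_trans (ltW wN).
have h0 n : 0 <= (w n)%:E * \d_(x_ n) (A `\` (K1 `|` K2)).
  by rewrite mule_ge0// lee_fin.
rewrite (nneseries_split 0%N N)//= add0n big_nat big1 ?add0e.
  apply: lee_nneseries => n //= _.
  by rewrite -[leRHS]mule1 lee_wpmul2l ?lee_fin.
move=> n /= nN; rewrite diracE memNset ?mule0//.
by move=> [Ax]; apply; right; split => //; exists n.
Qed.

(** The complement of a hull [H] of the complement of [E] is a measurable subset of [E] that misses
    only a null part of it. *)
Lemma completed_inner (nu : {measure set (measurableTypeR R) -> \bar R})
    (E : set R) (e : R) :
  (forall (A : set R) (e : R), measurable (A : set (measurableTypeR R)) ->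
    (0 < e)%R -> exists K : set R, [/\ compact K, K `<=` A & nu (A `\` K) <= e%:E]) ->
  nu setT < +oo -> (nu^*)%mu.-caratheodory E -> (0 < e)%R ->
  exists K : set R, [/\ compact K, K `<=` E & (nu^*)%mu (E `\` K) <= e%:E].
Proof.
move=> inner nufin cE e0.
have [H [mH EH muH]] := outer_hull nu (~` E).
have [K [cK KH Ke]] := inner (~` H) e (measurableC mH) e0.
exists K; split => //.
  by move=> x /KH; apply: contra_notP => Ex; exact: EH.
have fC : (nu^*)%mu (~` E) \is a fin_num.
  rewrite ge0_fin_numE ?outer_measure_ge0// -muH.
  by apply: le_lt_trans nufin; apply: le_measure; rewrite ?inE.
have N0 : (nu^*)%mu (H `&` E) = 0.
  have : (nu^*)%mu H = (nu^*)%mu (~` E) by rewrite -muH; exact: measurable_mu_extE.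
  by rewrite (cE H) (setIidr EH) => h; rewrite -[LHS](addeK _ fC) h subee.
have mK : measurable (K : set (measurableTypeR R)). by exact: compact_measurable.
apply: (@le_trans _ _ ((nu^*)%mu ((H `&` E) `|` (~` H `\` K)))).
  apply: le_outer_measure => x [Ex Kx].
  by have [Hx|nHx] := pselect (H x); [left|right].
apply: (le_trans (outer_measureU2 _ _ _)); rewrite -[leRHS]add0e.
apply: leeD; first by rewrite -N0.
apply: le_trans Ke.
rewrite le_eqVlt; apply/orP; left; apply/eqP; apply: measurable_mu_extE.
by apply: measurableD => //; exact: measurableC.
Qed.

Variables (d : measure_display) (Omega : measurableType d).
Variable P : probability Omega R.

(* A form of Lusin's theorem: the [E n] are made relatively clopen in a compact
   set [K] of the real line, and [Om1] corresponds to [K]. This is the only use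
   of standardness. *)
Lemma standard_compact (E : nat -> set Omega) (Om0 : set Omega) (e : R) :
  standard P -> (forall n, measurable (E n)) -> measurable Om0 -> P Om0 = 1 ->
  (0 < e)%R -> exists Om1 : set Omega, [/\ measurable Om1, 1 - e%:E <= P Om1 &
    forall b : nat -> bool,
      (forall N, exists2 o, Om1 o & forall n, (n < N)%N -> (o \in E n) = b n) ->
      exists2 o, Om0 o & forall n, (o \in E n) = b n].
Proof.
move=> [_ [nu [a [w [a0 w0 nuE iso]]]]] mE mOm0 P0 e0.
have [A1 [A2 [f [g [[mA1 PA1 mA2 QA2] [fA gA fK gK] mf mg Pf]]]]] := iso.
have PA1' : P A1 = 1.
  by rewrite -[A1]setCK probability_setC ?PA1 ?sube0//; exact: measurableC.
have nuT : (nu^*)%mu setT = 1.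
  rewrite (mA2 setT) !setTI [X in _ + X]QA2 adde0 -PA1'.
  have := Pf setT measurableT; rewrite preimage_setT !setIT.
  exact: esym.
have nufin : nu setT < +oo.
  by have <- : (nu^*)%mu setT = nu setT := measurable_mu_extE nu measurableT; rewrite nuT ltry.
have PA10 : P (A1 `&` Om0) = 1.
  have D : P Om0 = P (Om0 `\` A1) + P (Om0 `&` A1) := measureDI P mOm0 mA1.
  rewrite setIC -P0 D (_ : P (Om0 `\` A1) = 0) ?add0e//.
  apply: (@subset_measure0 _ _ _ P _ (~` A1)) => //.
  - exact: measurableD.
  - exact: measurableC.
(* [M] and the sets [F n] below carry [Om0] and the [E n] over to the real line. *)
pose M := A2 `&` g @^-1` (Om0 `&` A1).
have mM : (nu^*)%mu.-caratheodory M.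
  by apply: mg => //; exact: measurableI.
pose F n := A2 `&` g @^-1` (E n).
have mF n : (nu^*)%mu.-caratheodory (F n) by exact: mg.
have inner (B : set R) (e1 : R) : (nu^*)%mu.-caratheodory B -> (0 < e1)%R ->
    exists K : set R, [/\ compact K, K `<=` B & (nu^*)%mu (B `\` K) <= e1%:E].
  move=> mB e10; apply: completed_inner => // A e2 mA e20.
  exact: (interval_with_atoms_inner w0 nuE).
(* The errors [eps n] sum to [e]; each is shared equally by the parts of [M] inside and outside
   [F n]. *)
pose eps n := (e / (2 ^ n.+1)%:R)%R.
have eps0 n : (0 < eps n / 2)%R by rewrite !divr_gt0// ltr0n expn_gt0.
have /choice[K1 hK1] n := inner _ _ (caratheodory_measurable_setI mM (mF n)) (eps0 n).
have /choice[K2 hK2] n := inner _ _ (caratheodory_measurable_setD mM (mF n)) (eps0 n).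
pose K := \bigcap_n (K1 n `|` K2 n).
have cK12 n : compact (K1 n `|` K2 n).
  by apply: compactU; [case: (hK1 n)|case: (hK2 n)].
have clK1 n : closed (K1 n) by apply: compact_closed; [exact: Rhausdorff|case: (hK1 n)].
have clK2 n : closed (K2 n) by apply: compact_closed; [exact: Rhausdorff|case: (hK2 n)].
have clK : closed K by apply: closed_bigI => n _; exact: closedU.
have cK : compact K.
  by apply: (subclosed_compact _ (cK12 0%N)) => //; exact: bigcap_inf.
have KM : K `<=` M.
  by move=> x /(_ 0%N I)[]; [case: (hK1 0%N) => _ + _|case: (hK2 0%N) => _ + _] => /[apply] -[].
have KF n x : K x -> F n x = K1 n x.
  move=> /(_ n I) h; apply/propext; split=> [Fx|]; last first.
    by case: (hK1 n) => _ + _ => /[apply] -[].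
  by case: h => //; case: (hK2 n) => _ + _ => /[apply] -[].
have mK : (nu^*)%mu.-caratheodory K.
  apply: caratheodory_measurable_mu_ext; exact: compact_measurable.
exists (A1 `&` f @^-1` K); split.
- exact: mf.
- have PK : P (A1 `&` f @^-1` K) = (nu^*)%mu K.
    by rewrite (Pf K mK); congr (nu^*)%mu; rewrite setIidr// => x /KM[].
  have PM : (nu^*)%mu M = 1.
    rewrite -PA10 -(_ : A1 `&` f @^-1` M = A1 `&` Om0).
      apply/esym; rewrite (Pf M mM); congr (nu^*)%mu.
      by rewrite setIidr// => x [].
    apply/seteqP; split => [om [A1o [_ Oo]]|om [A1o Oo]].
      by move: Oo; rewrite /= fK ?inE// => -[].
    by split => //; split; [exact: fA|rewrite /= fK ?inE].
  rewrite PK leeBlDr// -PM (mK M) leeD//.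
    by apply: le_outer_measure => x [].
  apply: (@le_trans _ _ ((nu^*)%mu (\bigcup_n ((M `&` F n) `\` K1 n `|` (M `\` F n) `\` K2 n)))).
    apply: le_outer_measure => x [Mx]; rewrite /= => /existsNP[n /not_implyP[_ nK]].
    exists n => //; have [Fx|Fx] := pselect (F n x).
      by left; split => // ?; apply: nK; left.
    by right; split => // ?; apply: nK; right.
  apply: (le_trans (outer_measure_sigma_subadditive _ _)).
  apply: le_trans (epsilon_trick0 xpredT (ltW e0)).
  apply: lee_nneseries => [n _ _|n _]; first exact: outer_measure_ge0.
  apply: (le_trans (outer_measureU2 _ _ _)).
  rewrite -/(eps n) [eps n]splitr EFinD leeD//.
    by case: (hK1 n).
  by case: (hK2 n).
- move=> b hb.
  pose D n := if b n then K1 n else K2 n.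
  have KD n x : K x -> ((g x \in E n) = b n) <-> D n x.
    move=> Kx; have [A2x _] := KM _ Kx.
    have FE : F n x <-> E n (g x) by split=> [[]|]//.
    have FK := KF n x Kx; rewrite /D; case: (b n).
      by rewrite -FK; split=> [/set_mem/FE//|/FE Ex]; exact/mem_set.
    split=> [|K2x].
      move=> /negbT/negP nE; case: (Kx n I) => //; rewrite -FK => /FE Ex.
      by exfalso; apply: nE; exact/mem_set.
    apply/negbTE/negP => /set_mem/FE Fx.
    by case: (hK2 n) => _ /(_ _ K2x)[_ /(_ Fx)].
  (* The points of [K] with the first [N] bits of [b] form decreasing nonempty closed sets, so
     compactness yields a point with all the bits. *)
  pose C N := [set x | K x /\ forall n, (n < N)%N -> D n x].
  have clC N : closed (C N).
    have -> : C N = K `&` \bigcap_(n in `I_N) D n.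
      by apply/seteqP; split => x [Kx h]; split => // n; exact: h.
    apply: closedI => //; apply: closed_bigI => n _.
    by rewrite /D; case: (b n).
  have C0 N : C N !=set0.
    have [om [A1o Ko] ho] := hb N; exists (f om); split => // n nN.
    by apply/(KD n _ Ko); rewrite fK ?inE//; exact: ho.
  have CI N N' : (N <= N')%N -> C N' `<=` C N.
    by move=> NN x [Kx h]; split => // n nN; apply: h; exact: leq_trans NN.
  have FF : ProperFilter (filter_from setT C).
    apply: filter_from_proper => [|N _]; last exact: C0.
    apply: filter_from_filter; first by exists 0%N.
    move=> N N' _ _; exists (maxn N N') => // x Cx.
    by split; apply: CI Cx; rewrite ?leq_maxl ?leq_maxr.
  have FKC : filter_from setT C K by exists 0%N => // x [].
  have [r [Kr]] := cK _ FF FKC.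
  rewrite clusterE => clr.
  have Cr N : C N r.
    have /closure_id -> := clC N; apply: clr; exists N => //.
  exists (g r) => [|n]; first by have [_ []] := KM _ Kr.
  by apply/(KD n _ Kr); have [_] := Cr n.+1; apply.
Qed.

End standard_space.

(** * Events given by finitely many bits or by distances, and stationarity *)

(** Only finitely many bit strings have length [N], so [Q] may be arbitrary; the induction splits on
    the last bit. *)
Lemma measurable_prefix d (T : measurableType d) (b : nat -> T -> bool) :
  (forall n, measurable [set x | b n x]) ->
  forall N (Q : set (seq bool)), measurable [set x | Q (mkseq (b^~ x) N)].
Proof.
move=> mb; elim=> [|N IH] Q.
  by have [Q0|Q0] := pselect (Q [::]); [rewrite (_ : [set _ | _] = setT)|
    rewrite (_ : [set _ | _] = set0)] => //; apply/seteqP; split.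
rewrite (_ : [set _ | _] =
  ([set x | b N x] `&` [set x | [set s | Q (rcons s true)] (mkseq (b^~ x) N)]) `|`
  (~` [set x | b N x] `&` [set x | [set s | Q (rcons s false)] (mkseq (b^~ x) N)])).
  apply: measurableU; first by apply: measurableI => //; exact: IH.
  by apply: measurableI; [exact: measurableC|exact: IH].
apply/seteqP; split => x /=; rewrite mkseqS; case: (b N x).
- by left.
- by right.
- by case=> -[].
- by case=> -[].
Qed.

Section measurable_distance.
Variables (R : realType) (X : ptopologicalType) (rho : X -> X -> R).
Hypotheses (hrho : metric_for rho) (sX : separable X).

Lemma borel_preimage_open d (T : measurableType d) (u : T -> X) (U : set X) :
  measurable_fun setT (u : T -> borel X) -> open U -> measurable (u @^-1` U).
Proof.
move=> mu oU; rewrite -[X in measurable X]setTI; apply: mu => //.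
exact: sub_sigma_algebra.
Qed.

(** The distance is below [r] exactly when, for some [n], a point [xs k] is within [n.+1%:R^-1] of
    [u x] and within [r - n.+1%:R^-1] of [v x]. *)
Lemma measurable_rho_lt d (T : measurableType d) (u v : T -> X) (r : R) :
  measurable_fun setT (u : T -> borel X) -> measurable_fun setT (v : T -> borel X) ->
  measurable [set x | (rho (u x) (v x) < r)%R].
Proof.
move=> mu mv; have [xs hxs] := rho_dense_sequence hrho sX.
rewrite (_ : [set _ | _] = \bigcup_n \bigcup_k
  (u @^-1` [set y | (rho (xs k) y < n.+1%:R^-1)%R] `&`
   v @^-1` [set y | (rho (xs k) y < r - n.+1%:R^-1)%R])).
  apply: bigcupT_measurable => n; apply: bigcupT_measurable => k.
  by apply: measurableI; apply: borel_preimage_open => //; exact: open_rho.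
apply/seteqP; split => [x /= uv|x [n _ [k _ [/= ux vx]]]]; last first.
  apply: (le_lt_trans (rho_tri hrho _ (xs k) _)).
  rewrite (rho_sym hrho) -(subrK n.+1%:R^-1 r)%R.
  by rewrite addrC ltrD.
have d0 : (0 < (r - rho (u x) (v x)) / 2)%R by rewrite divr_gt0// subr_gt0.
have [n nd] : exists n : nat, (n.+1%:R^-1 < (r - rho (u x) (v x)) / 2 :> R)%R.
  exists (Num.truncn ((r - rho (u x) (v x)) / 2)^-1).
  by rewrite invf_plt ?posrE//; exact: truncnS_gt.
have n0 : (0 < n.+1%:R^-1 :> R)%R by [].
have [k xk] := hxs (u x) _ n0.
exists n => //; exists k => //; split => /=; first by rewrite (rho_sym hrho).
apply: (le_lt_trans (rho_tri hrho _ (u x) _)).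
rewrite (rho_sym hrho (xs k)).
by move: xk nd; set c := (n.+1%:R^-1)%R; lra.
Qed.

End measurable_distance.

Section stationarity.
Variables (R : realType) (d : measure_display) (Omega : measurableType d).
Variables (P : probability Omega R) (X : ptopologicalType) (G : topologicalGroupType).
Variable Y : G -> Omega -> X.
Hypothesis statY : stationary P Y.

Lemma stationary_prefix (g : G) (p : nat -> G) (O : nat -> set X) N (Q : set (seq bool)) :
  (forall n, open (O n)) ->
  P [set o | Q (mkseq (fun n => Y (g * p n)%g o \in O n) N)] =
  P [set o | Q (mkseq (fun n => Y (p n) o \in O n) N)].
Proof.
move=> oO.
pose A : set (N.-tuple (borel X)) :=
  [set v | Q (mkseq (fun n => nth point v n \in O n) N)].
have mA : measurable A.
  apply: (@measurable_prefix _ (N.-tuple (borel X)) (fun n v => nth point v n \in O n)) => n.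
  have [nN|nN] := ltnP n N.
    rewrite (_ : [set _ | _] = (fun v => tnth v (Ordinal nN)) @^-1` O n).
      rewrite -[X in measurable X]setTI; apply: measurable_tnth => //.
      exact: sub_sigma_algebra.
    by apply/seteqP; split => v /=; rewrite (tnth_nth point) inE.
  (* Beyond the length of the tuple [nth] returns [point], so the bit is constant. *)
  have [p0|p0] := pselect (O n point).
    rewrite (_ : [set _ | _] = setT)//; apply/seteqP; split => v //= _.
    by rewrite nth_default ?size_tuple// inE.
  rewrite (_ : [set _ | _] = set0)//; apply/seteqP; split => v //=.
  by rewrite nth_default ?size_tuple// inE.
have nthE (F : 'I_N -> X) n (nN : (n < N)%N) :
    nth point (mktuple F : seq (borel X)) n = F (Ordinal nN).
  by rewrite -(tnth_nth point (mktuple F) (Ordinal nN)) tnth_mktuple.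
have AE (F : nat -> G) o :
    A [tuple Y (F i) o | i < N] = Q (mkseq (fun n => Y (F n) o \in O n) N).
  rewrite /A /=; congr Q; apply/eq_in_map => n; rewrite mem_iota => /= nN.
  by rewrite nthE.
have := @statY N g [tuple p i | i < N] A mA; rewrite /pushforward.
have -> : (fun o => [tuple Y (g * tnth [tuple p i | i < N] i)%g o | i < N]) @^-1` A =
    [set o | Q (mkseq (fun n => Y (g * p n)%g o \in O n) N)].
  apply/funext => o; apply: etrans (AE (fun n => (g * p n)%g) o); apply: (congr1 A).
  by apply: eq_mktuple => i; rewrite tnth_mktuple.
move=> ->; congr (P _); apply/funext => o; apply: etrans (AE p o); apply: (congr1 A).
by apply: eq_mktuple => i; rewrite tnth_mktuple.
Qed.

Lemma stationary_rho (rho : X -> X -> R) (g a b : G) (r : R) :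
  metric_for rho -> separable X ->
  P [set o | (rho (Y (g * a)%g o) (Y (g * b)%g o) < r)%R] =
  P [set o | (rho (Y a o) (Y b o) < r)%R].
Proof.
move=> hrho sX.
pose A : set (2.-tuple (borel X)) := [set v | (rho (tnth v ord0) (tnth v (lift ord0 ord0)) < r)%R].
have mA : measurable A.
  by apply: (@measurable_rho_lt R X rho hrho sX _ (2.-tuple (borel X))%type
    (fun v => tnth v ord0) (fun v => tnth v (lift ord0 ord0))); exact: measurable_tnth.
have := @statY 2%N g [tuple a; b] A mA; rewrite /pushforward.
rewrite (_ : _ @^-1` A = [set o | (rho (Y (g * a)%g o) (Y (g * b)%g o) < r)%R]).
  move=> ->; congr (P _); apply/seteqP; split => o; rewrite /A /= !tnth_mktuple//.
by apply/seteqP; split => o; rewrite /A /= !tnth_mktuple.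
Qed.

End stationarity.

Lemma ae_measure_eq d (T : measurableType d) (R : realType)
    (m : {measure set T -> \bar R}) (A B : set T) :
  measurable A -> measurable B -> (\forall x \ae m, A x <-> B x) -> m A = m B.
Proof.
move=> mA mB [N [mN N0 hN]].
suff le (C D : set T) : measurable C -> measurable D ->
    (forall x, ~ N x -> C x -> D x) -> m C <= m D.
  by apply/eqP; rewrite eq_le; apply/andP; split; apply: le => // x Nx;
    have [] : A x <-> B x by apply: contrapT => h; apply: Nx; exact: hN.
move=> mC mD CD; apply: (@le_trans _ _ (m (D `|` N))).
  apply: le_measure; rewrite ?inE//; first exact: measurableU.
  by move=> x Cx; have [Nx|Nx] := pselect (N x); [right|left; exact: CD].
by rewrite measureU0.
Qed.

Lemma ae_countType d (T : measurableType d) (R : realType)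
    (m : {measure set T -> \bar R}) (I : countType) (Q : I -> T -> Prop) :
  (forall i, \forall x \ae m, Q i x) -> \forall x \ae m, forall i, Q i x.
Proof.
move=> h; have : \forall x \ae m, forall n,
    if @unpickle I n is Some i then Q i x else True.
  by apply: ae_foralln => n; case: unpickle => [i|]; [exact: h|exact: aeW].
by apply: filterS => x hx i; have := hx (pickle i); rewrite pickleK.
Qed.

Lemma bigcap_countType_measurable d (T : measurableType d) (I : countType)
    (F : I -> set T) : (forall i, measurable (F i)) -> measurable (\bigcap_i F i).
Proof.
move=> mF; rewrite -[X in measurable X]setCK setC_bigcap; apply: measurableC.
apply: countable_bigcupT_measurable; first exact: countableP.
by move=> i; exact: measurableC.
Qed.

(** * A countable family of sets encoding a natural modification *)

Section natural_modification.
Variables (R : realType) (d : measure_display) (Omega : measurableType d).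
Variables (P : probability Omega R) (X : ptopologicalType) (G : topologicalGroupType).
Variables (rho : X -> X -> R) (hrho : metric_for rho).
Hypothesis polG : polish R G.

(** The second countable topology on [T] and the topology of [G] are merged into one countable
    family of subsets of [G], indexed by finite lists so that concatenation is intersection. *)
Lemma natural_family (Y : G -> Omega -> X) (T : set G) :
  has_natural_modification P (restrict_field (T := T) Y) ->
  exists (z : Omega -> G -> X) (W : seq nat -> set G),
  [/\ W [::] = T, forall J K, W (J ++ K) = W J `&` W K,
      forall t U, T t -> nbhs t U -> exists J, W J t /\ W J `<=` U,
      forall t, T t -> \forall o \ae P, z o t = Y t o &
      \forall o \ae P, forall t (e : R), T t -> (0 < e)%R ->
        exists J, W J t /\ forall u, W J u -> (rho (z o t) (z o u) < e)%R].
Proof.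
move=> [xi ximod [c [B cB [Bo Bb]] xic]].
have [b [bo bb]] := group_countable_base polG.
have /countable_injP[f finj] := cB.
(* [C n] is the member of [B] with code [n], seen in [G]. Points outside [T] satisfy it vacuously,
   and so do all points if no member has this code. *)
pose C n : set G := [set g | forall x : T, set_val x = g -> forall V, B V -> f V = n -> V x].
(* Odd indices code the base of [G], even ones the base of the topology on [T]. *)
pose e n := if odd n then b n./2 else C n./2.
pose W (J : seq nat) := T `&` [set g | forall j, j \in J -> e j g].
pose z o g := if pselect (T g) is left Tg then xi o (SigSub (mem_set Tg)) else point.
have zE o (x : T) : z o (set_val x) = xi o x.
  rewrite /z; case: pselect => [Tx|]; last by case; exact: set_valP.
  by congr xi; apply: val_inj.
exists z, W; split.
- by apply/seteqP; split => [g []//|g Tg]; split.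
- move=> J K; apply/seteqP; split => [g [Tg h]|g [[Tg h1] [_ h2]]].
    by split; split => // j jJ; apply: h; rewrite mem_cat jJ ?orbT.
  by split => // j; rewrite mem_cat => /orP[]; [exact: h1|exact: h2].
- move=> t U Tt /bb[n [bnt bnU]]; exists [:: n.*2.+1]; split.
    by split => // j; rewrite inE => /eqP ->; rewrite /e/= odd_double /= uphalf_double.
  move=> u [_ /(_ n.*2.+1)]; rewrite inE eqxx => /(_ isT).
  by rewrite /e/= odd_double /= uphalf_double; exact: bnU.
- move=> t Tt; pose x : T := SigSub (mem_set Tt).
  have := ximod x; apply: filterS => o.
  by rewrite -zE.
- move: xic; apply: filterS => o cxi t ep Tt ep0.
  pose x : T := SigSub (mem_set Tt).
  have := cxi x _ (nbhs_rho hrho (xi o x) ep0).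
  move=> /(Bb x)[V [BV Vx] VU].
  exists [:: (f V).*2]; split.
    split => // j; rewrite inE => /eqP ->; rewrite /e odd_double doubleK => x' xx' V' BV' ff.
    rewrite (finj V' V) ?inE// (_ : x' = x)//; exact: val_inj.
  move=> u [Tu /(_ (f V).*2)]; rewrite inE eqxx => /(_ isT).
  rewrite /e odd_double doubleK => /(_ (SigSub (mem_set Tu)) erefl V BV erefl) Vu.
  have := VU _ Vu; rewrite /= -!zE//.
Qed.

End natural_modification.

(** * Continuity in probability *)

Section natural_modification_nonnull.
Variables (R : realType) (d : measure_display) (Omega : measurableType d).
Variables (P : probability Omega R) (X : ptopologicalType) (G : topologicalGroupType).
Variable mu : {measure set (borel G) -> \bar R}.
Variables (rho : X -> X -> R) (hrho : metric_for rho).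
Hypothesis sX : separable X.
Hypothesis lcG : locally_compact [set: G].
Hypothesis polG : polish R G.
Hypothesis haar : left_haar mu.
Variable Y : G -> Omega -> X.
Hypothesis mY : stochastic_field Y.
Hypothesis statY : stationary P Y.
Variable f : Omega -> G -> X.
Hypothesis fY : modification P Y f.
Hypothesis mf : measurable_fun setT
  ((fun p => f p.1 p.2) : Omega * caratheodory_type (mu^*)%mu -> borel X).
Variables (T : set G) (z : Omega -> G -> X) (W : seq nat -> set G).
Hypothesis T0 : 0 < (mu^*)%mu T.
Hypothesis W0 : W [::] = T.
Hypothesis Wcat : forall J K, W (J ++ K) = W J `&` W K.
Hypothesis Wnbhs : forall t U, T t -> nbhs t U -> exists J, W J t /\ W J `<=` U.
Hypothesis zY : forall t, T t -> \forall o \ae P, z o t = Y t o.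
Hypothesis zW : \forall o \ae P, forall t (e : R), T t -> (0 < e)%R ->
  exists J, W J t /\ forall u, W J u -> (rho (z o t) (z o u) < e)%R.

Hypothesis stdP : standard P.
Variables (xs : nat -> X) (dG : nat -> G).
Hypothesis hxs : forall x (e : R), (0 < e)%R -> exists n, (rho x (xs n) < e)%R.
Hypothesis hdG : forall U : set G, open U -> U !=set0 -> exists n, U (dG n).

Local Notation mus := (mu^*)%mu.

(** If [W J] is empty this is the arbitrary [point], hence the conditions [W J (s J)] in what
    follows. *)
Definition sample_point (J : seq nat) : G := xget point (W J).
Local Notation s := sample_point.

Lemma sample_pointP J t : W J t -> W J (s J).
Proof. exact: xgetI. Qed.

Lemma W_subT J : W J `<=` T.
Proof. by move=> t; rewrite -W0 -(cats0 J) Wcat => -[]. Qed.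

(** Concatenating, in the order of an enumeration, all lists [K] with [t] in [W K] gives a
    decreasing base at [t]. *)
Lemma W_base t : T t -> exists J : nat -> seq nat, (forall n, W (J n) t) /\
  forall K, W K t -> exists N, forall n, (N <= n)%N -> W (J n) `<=` W K.
Proof.
move=> Tt.
pose L n := odflt [::] (@unpickle (seq nat) n).
pose J := fix J n := if n is m.+1 then
  if `[< W (L m) t >] then L m ++ J m else J m else [::].
have JE n : J n.+1 = if `[< W (L n) t >] then L n ++ J n else J n by [].
have Jt n : W (J n) t.
  elim: n => [|n IH]; first by rewrite /J W0.
  rewrite JE; have [h|h] := pselect (W (L n) t).
    by rewrite asboolT// Wcat.
  by rewrite asboolF.
exists J; split => // K Kt.
have JS n : W (J n.+1) `<=` W (J n).
  rewrite JE; have [h|h] := pselect (W (L n) t).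
    by rewrite asboolT// Wcat => ? [].
  by rewrite asboolF.
exists (pickle K).+1 => n /subnK <-; elim: (n - _)%N => [|m IH]; last first.
  by rewrite addSn; exact: subset_trans (JS _) IH.
rewrite add0n JE.
have -> : L (pickle K) = K by rewrite /L pickleK.
by rewrite asboolT// Wcat => ? [].
Qed.

Definition near_event (a b : G) (r : R) := [set o | (rho (Y a o) (Y b o) < r)%R].

Lemma measurable_near_event a b r : measurable (near_event a b r).
Proof. exact: (measurable_rho_lt hrho sX). Qed.

(* Distance less than [r] in the Ky Fan metric of convergence in probability. *)
Definition near_prob (a b : G) (r : R) := P (~` near_event a b r) < r%:E.

Lemma near_prob_translate g a b r : near_prob (g * a)%g (g * b)%g r = near_prob a b r.
Proof.
rewrite /near_prob !probability_setC; [|exact: measurable_near_event..].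
have -> : P (near_event (g * a)%g (g * b)%g r) = P (near_event a b r).
  exact: (stationary_rho statY g a b r hrho sX).
by [].
Qed.

Lemma near_prob_sym a b r : near_prob a b r = near_prob b a r.
Proof.
rewrite /near_prob (_ : near_event a b r = near_event b a r)//.
by apply/seteqP; split => o; rewrite /near_event /= (rho_sym hrho).
Qed.

Lemma near_prob_tri a b c r q :
  near_prob a b r -> near_prob b c q -> near_prob a c (r + q).
Proof.
rewrite /near_prob => h1 h2; rewrite EFinD.
apply: le_lt_trans (lteD h1 h2).
have m1 := measurableC (measurable_near_event a b r).
have m2 := measurableC (measurable_near_event b c q).
apply: le_trans (measureU2 P m1 m2); apply: le_measure; rewrite ?inE.
- by apply: measurableC; exact: measurable_near_event.
- exact: measurableU.
- move=> o /= /negP; rewrite -leNgt => h; apply/not_andP => -[h1' h2'].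
  move: h; rewrite leNgt => /negP; apply.
  by apply: (le_lt_trans (rho_tri hrho _ (Y b o) _)); rewrite ltrD.
Qed.

(** Along a decreasing base at [t] the paths of [z] force [Y (s (J n))] to converge to [Y t] almost
    surely, hence in probability. *)
Lemma sample_point_near t (r : R) : T t -> (0 < r)%R -> exists K, near_prob (s K) t r.
Proof.
move=> Tt r0; have [J [Jt JW]] := W_base Tt.
pose A n := ~` near_event (s (J n)) t r.
have mA n : measurable (A n) by apply: measurableC; exact: measurable_near_event.
have ae0 : \forall o \ae P, (lim_sup_set A) o <-> set0 o.
  have zs : \forall o \ae P, forall n, z o (s (J n)) = Y (s (J n)) o.
    by apply: ae_foralln => n; apply: zY; apply: (@W_subT (J n)); exact: sample_pointP (Jt n).
  apply: filterS3 (zY Tt) zs zW => o zt zs' zw; split => // lo.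
  have [K [Kt hK]] := zw t r Tt r0.
  have [N hN] := JW K Kt.
  have [n /= Nn] := lo N I; rewrite /A /near_event /=; apply.
  rewrite -zs' -zt (rho_sym hrho); apply: hK; apply: (hN n Nn); exact: sample_pointP (Jt n).
have ml : measurable (lim_sup_set A).
  by apply: bigcapT_measurable => n; apply: bigcup_measurable.
have l0 : P (lim_sup_set A) = 0.
  by rewrite (ae_measure_eq ml measurable0 ae0) measure0.
have mU n : measurable (\bigcup_(k >= n) A k) by exact: bigcup_measurable.
have cv : P (\bigcup_(k >= n) A k) @[n --> \oo] --> P (lim_sup_set A).
  apply: lim_sup_set_cvg => //.
  by apply: le_lt_trans (ltry 1); exact: probability_le1.
rewrite l0 in cv.
have n0 : nbhs (0 : \bar R) [set x | x < r%:E].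
  by apply: open_nbhs_nbhs; split; [exact: open_ereal_lt_ereal|rewrite /= lte_fin].
have [N _ hN] := cv _ n0.
exists (J N); apply: le_lt_trans (hN N (leqnn N)).
by apply: le_measure; [rewrite inE; exact: mA|rewrite inE; exact: mU|move=> o Ao; exists N => /=].
Qed.

Definition near_one (r : R) : set G := [set g | near_prob 1%g g r].

(** The probability of a section of a jointly measurable set is measurable in [g]; [f] supplies the
    joint measurability and, for each fixed [g], agrees with [Y g] almost surely. *)
Lemma caratheodory_near_one r : mus.-caratheodory (near_one r).
Proof.
pose E : set (Omega * caratheodory_type mus) :=
  ~` [set p | (rho (Y 1%g p.1) (f p.1 p.2) < r)%R].
have mE : measurable E.
  apply: measurableC; apply: (measurable_rho_lt hrho sX) => //.
  exact: measurableT_comp (mY 1%g) measurable_fst.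
have mPE := measurable_fun_ysection P mE.
have -> : near_one r = (fun g => P (ysection E g)) @^-1` [set x | x < r%:E].
  apply/funext => g; rewrite /near_one /near_prob /=; congr (_ < _).
  apply: ae_measure_eq.
  - by apply: measurableC; exact: measurable_near_event.
  - exact: measurable_ysection.
  have := fY g; apply: filterS => o; rewrite /ysection/= inE /E /near_event /= => ->.
  by [].
rewrite -[X in mus.-caratheodory X]setTI; apply: mPE => //.
rewrite (_ : [set x | x < r%:E] = `]-oo, r%:E[%classic).
  exact: emeasurable_itv.
by apply/seteqP; split => x; rewrite /= in_itv.
Qed.

(** The translates of the ball [near_one (r / 2)] by the countably many [s K] cover [T], so this
    ball is non-null. By Steinhaus, for [v] near 1 it contains some [x] together with [v^-1 * x],
    and [x] links 1 to [v]. *)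
Lemma near_one_nbhs r : (0 < r)%R -> \forall g \near (1%g : G), near_prob 1%g g r.
Proof.
move=> r0; have r2 : (0 < r / 2)%R by rewrite divr_gt0.
have N0 : 0 < mus (near_one (r / 2)).
  rewrite lt0e outer_measure_ge0 andbT; apply/eqP => h.
  suff : mus T = 0 by move: T0 => /[swap] ->; rewrite ltxx.
  apply: (@outer_nullS (borel G) _ _ _
    (\bigcup_K [set t | near_one (r / 2) ((s K)^-1 * t)%g])).
    move=> t /sample_point_near/(_ r2)[K hK]; exists K => //.
    by rewrite /near_one /= -(near_prob_translate (s K)) mulg1 mulVKg.
  apply: (@outer_null_bigcup (borel G)) => K.
  exact: etrans (outer_translate haar (s K) _) h.
have := steinhaus lcG polG haar (caratheodory_near_one (r / 2)) N0.
apply: filterS => v vN.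
have [x [Bx Bvx]] : exists x, near_one (r / 2) x /\ near_one (r / 2) (v^-1 * x)%g.
  apply: contrapT => /forallNP h; move: vN.
  rewrite (_ : _ `&` _ = set0) ?outer_measure0 ?ltxx//.
  by apply/seteqP; split => x // [? ?]; exact: (h x).
rewrite (splitr r); apply: (near_prob_tri Bx).
by rewrite near_prob_sym -(near_prob_translate v^-1%g) mulVg.
Qed.

Lemma near_prob_nbhs x r : (0 < r)%R -> \forall y \near x, near_prob x y r.
Proof.
move=> r0.
have h : \forall y \near x, near_prob 1%g (x^-1 * y)%g r.
  apply: (@mulg_l_continuous G x^-1%g x [set g | near_prob 1%g g r]).
  by rewrite mulVg; exact: near_one_nbhs.
by apply: filterS h => y; rewrite -(near_prob_translate x) mulg1 mulVKg.
Qed.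

(** * Good sequences and their invariance under left translation *)

(** The sampled values converge as [W J] shrinks to [t]. The existence of the limit is part of the
    condition, since [X] may be incomplete. *)
Definition good (h : seq nat -> X) := forall t, T t -> exists x, forall e : R,
  (0 < e)%R -> exists J, W J t /\ forall I, W J (s I) -> (rho (h I) x < e)%R.

Lemma good_sample : \forall o \ae P, good (fun I => Y (s I) o).
Proof.
have zs : \forall o \ae P, forall I : seq nat, T (s I) -> z o (s I) = Y (s I) o.
  apply: ae_countType => I.
  have [Ts|nT] := pselect (T (s I)); last exact: aeW.
  by have := zY Ts; apply: filterS => o ? _.
apply: filterS2 zs zW => o zs' zw t Tt; exists (z o t) => e e0.
have [J [Jt hJ]] := zw t e Tt e0; exists J; split => // I WI.
by rewrite (rho_sym hrho) -zs'; [exact: hJ|exact: W_subT WI].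
Qed.

(** Right translations need not preserve [mu], but they preserve Haar measurability. *)
Lemma measurable_fun_rtranslate x :
  measurable_fun setT ((fun p => f p.1 (p.2 * x)%g) :
    Omega * caratheodory_type mus -> borel X).
Proof.
pose h (p : Omega * caratheodory_type mus) : Omega * caratheodory_type mus :=
  (p.1, (p.2 * x)%g).
have mh : measurable_fun setT h.
  apply/measurable_fun_pairP; split; first exact: measurable_fst.
  have mr : measurable_fun setT ((fun g => (g * x)%g) :
      caratheodory_type mus -> caratheodory_type mus).
    by move=> _ A mA; rewrite setTI; exact: caratheodory_rtranslate.
  exact: (measurableT_comp mr measurable_snd).
exact: (measurableT_comp mf mh).
Qed.

(* The bits [h I \in ball (xs k) n.+1^-1] encode the sequence [h]; they are
   enumerated by decoding [m] into [(I, k, n)]. *)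
Let dec m : seq nat * nat * nat := odflt ([::], 0, 0)%N (unpickle m).
Let O m : set X := [set y | (rho (xs (dec m).1.2) y < (dec m).2.+1%:R^-1)%R].

Let oO m : open (O m). Proof. exact: open_rho. Qed.

Let bits_inj (h h' : seq nat -> X) :
  (forall m, (h (dec m).1.1 \in O m) = (h' (dec m).1.1 \in O m)) -> h = h'.
Proof.
move=> hh; apply/funext => I; apply: (rho_sep hrho); apply/eqP/negPn/negP => d0.
have {}d0 : (0 < rho (h I) (h' I) / 2)%R by rewrite divr_gt0// lt0r d0 (rho_ge0 hrho).
have [n nd] : exists n : nat, (n.+1%:R^-1 < rho (h I) (h' I) / 2 :> R)%R.
  exists (Num.truncn (rho (h I) (h' I) / 2)^-1).
  by rewrite invf_plt ?posrE//; exact: truncnS_gt.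
have n0 : (0 < n.+1%:R^-1 :> R)%R by [].
have [k hk] := hxs (h I) n0.
have := hh (pickle (I, k, n)); rewrite /O /dec pickleK /= => /esym.
rewrite [X in _ = X]mem_set /=; last by rewrite (rho_sym hrho).
move=> /set_mem /= hk'.
have := rho_tri hrho (h I) (xs k) (h' I); move: hk hk' nd; set c := (_^-1)%R; lra.
Qed.

Let p m := s (dec m).1.1.

(** For fixed [g], stationarity makes each finite prefix of the translated bits occur on [Om1 j] up
    to probability [j.+1%:R^-1]. If all prefixes occur, compactness gives an outcome in the good
    event with the same whole sequence. Fubini then passes to fixed [o]. *)
Lemma good_translate : \forall o \ae P, exists2 N, mus N = 0 &
  forall g, ~ N g -> good (fun I => f o (g * s I)%g).
Proof.
have [N0 [mN0 PN0 hN0]] := good_sample.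
have mOm0 := measurableC mN0.
have POm0 : P (~` N0) = 1 by rewrite probability_setC// PN0 sube0.
pose E m := [set o | O m (Y (p m) o)].
have mE m : measurable (E m) by exact: borel_preimage_open.
have j0 j : (0 < j.+1%:R^-1 :> R)%R by [].
have /choice[Om1 hOm1] j := standard_compact stdP mE mOm0 POm0 (j0 j).
pose Q j N : set (seq bool) := [set u | exists2 o, Om1 j o &
  u = mkseq (fun m => Y (p m) o \in O m) N].
pose pf N (q : Omega * caratheodory_type mus) :=
  mkseq (fun m => f q.1 (q.2 * p m)%g \in O m) N.
(* These are the pairs whose prefix of length [N] never occurs on [Om1 j]; [BE] asks for such an [N]
   for every [j]. *)
pose B j N : set (Omega * caratheodory_type mus) := ~` [set q | Q j N (pf N q)].
have mB j N : measurable (B j N).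
  apply: measurableC; apply: (@measurable_prefix _ _
    (fun m (q : Omega * caratheodory_type mus) => f q.1 (q.2 * p m)%g \in O m)) => m.
  have := borel_preimage_open (measurable_fun_rtranslate (p m)) (oO m).
  by congr measurable; apply/seteqP; split => q /=; rewrite inE.
pose BE := \bigcap_j \bigcup_N B j N.
have mBE : measurable BE.
  by apply: bigcapT_measurable => j; exact: bigcupT_measurable.
have PB j N g : P (ysection (B j N) g) <= j.+1%:R^-1%:E.
  have mS h : measurable [set o | Q j N (mkseq (fun m => Y (h m) o \in O m) N)].
    apply: (@measurable_prefix _ _ (fun m o => Y (h m) o \in O m)) => m.
    have := borel_preimage_open (mY (h m)) (oO m).
    by congr measurable; apply/seteqP; split => q /=; rewrite inE.
  have -> : P (ysection (B j N) g) =
      P (~` [set o | Q j N (mkseq (fun m => Y (g * p m)%g o \in O m) N)]).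
    apply: ae_measure_eq; [exact: measurable_ysection|exact: measurableC|].
    have : \forall o \ae P, forall m, f o (g * p m)%g = Y (g * p m)%g o.
      by apply: ae_foralln => m; exact: fY.
    apply: filterS => o fo; rewrite /ysection /B /pf /= inE /=.
    have -> // : mkseq (fun m => f o (g * p m)%g \in O m) N =
      mkseq (fun m => Y (g * p m)%g o \in O m) N.
    by apply: eq_map => m; rewrite fo.
  rewrite probability_setC//.
  have -> : P [set o | Q j N (mkseq (fun m => Y (g * p m)%g o \in O m) N)] =
      P [set o | Q j N (mkseq (fun m => Y (p m) o \in O m) N)].
    exact: stationary_prefix.
  have [mO PO _] := hOm1 j.
  have le : P (Om1 j) <= P [set o | Q j N (mkseq (fun m => Y (p m) o \in O m) N)].
    by apply: le_measure; [rewrite inE|rewrite inE; exact: mS|move=> o Oo; exists o].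
  rewrite leeBlDl; last by rewrite fin_num_measure//; exact: mS.
  by rewrite addeC -leeBlDl//; exact: le_trans le.
have BE0 g : P (ysection BE g) = 0.
  apply/eqP; rewrite eq_le measure_ge0 andbT; apply/lee_addgt0Pr => e e0; rewrite add0e.
  have [j je] : exists j : nat, (j.+1%:R^-1 < e :> R)%R.
    by exists (Num.truncn e^-1); rewrite invf_plt ?posrE//; exact: truncnS_gt.
  have mU : measurable (\bigcup_N ysection (B j N) g).
    by apply: bigcupT_measurable => N; exact: measurable_ysection.
  apply: (@le_trans _ _ (P (\bigcup_N ysection (B j N) g))).
    apply: le_measure; rewrite ?inE//; first exact: measurable_ysection.
    move=> o; rewrite /ysection /= inE => /(_ j I)[N _ BN].
    by exists N => //; rewrite /ysection /= inE.
  (* No extension of a non-occurring prefix occurs, so [B j N] grows with [N] and the bound [PB]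
     passes to the union. *)
  have cv : P (ysection (B j N) g) @[N --> \oo] --> P (\bigcup_N ysection (B j N) g).
    apply: nondecreasing_cvg_mu => // [N|]; first exact: measurable_ysection.
    move=> N N' NN'; apply/subsetPset => o; rewrite /ysection /= !inE /B /= => nQ [w Ow E'].
    apply: nQ; exists w => //; apply/eq_in_map => m; rewrite mem_iota /= => mN.
    have mN' : (m < N')%N by exact: leq_trans NN'.
    have := congr1 (fun u => nth true u m) E'; rewrite /pf !nth_mkseq//.
  rewrite -(cvg_lim _ cv)//; apply: (@le_trans _ _ (j.+1%:R^-1%:E)); last by rewrite lee_fin ltW.
  by apply: lime_le; [apply/cvg_ex; eexists; exact: cv|apply: nearW => N; exact: PB].
have sfP : sigma_finite setT P by exact: sigma_finiteT.
have sfm := completed_measure_extension_sigma_finite (haar_sigma_finite lcG polG haar).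
have := fubini_null sfP sfm mBE BE0.
apply: filterS => o o0; exists (xsection BE o) => // g ng.
have [j hj] : exists j, forall N, Q j N (pf N (o, g)).
  apply: contrapT => /forallNP h; apply: ng; rewrite /xsection /= inE => j _.
  by have /existsNP[N hN] := h j; exists N.
have [_ _ /(_ (fun m => f o (g * p m)%g \in O m))] := hOm1 j.
case.
  move=> N; have [w Ow E'] := hj N; exists w => // m mN.
  have := congr1 (fun u => nth true u m) E'; rewrite /pf !nth_mkseq//= => ->.
move=> o' No' ho'.
have -> : (fun I => f o (g * s I)%g) = (fun I => Y (s I) o').
  apply: bits_inj => m; rewrite -[LHS]ho'.
  by apply/idP/idP => /set_mem ?; exact/mem_set.
by apply: contrapT => h; apply: No'; exact: hN0.
Qed.

(** * Approximation of values through closures of translates *)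

(** The condition says that [x] lies in [g] times the closure of [W J]. The closure makes the set
    closed in [g], while [W J] may be non-measurable. *)
Definition closed_translate (x : G) (J : seq nat) := [set g | closure (W J) (g^-1 * x)%g].

Lemma caratheodory_closed_translate x J : mus.-caratheodory (closed_translate x J).
Proof.
apply: borel_caratheodory; apply: closed_borel.
have cf : continuous (fun g : G => (g^-1 * x)%g).
  move=> g; apply: (@continuous_comp _ _ _ (fun g : G => g^-1%g) (fun g => (g * x)%g)).
    exact: invg_continuous.
  exact: mulg_r_continuous.
exact: ((continuous_closedP _).1 cf _ (@closed_closure G (W J))).
Qed.

(** Some [t] in [W J] is close to [g^-1 * x]; a small [W K] around [t], intersected with [W J],
    contains its own sample point. *)
Lemma closed_translate_near x J g (r : R) : closed_translate x J g -> (0 < r)%R ->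
  exists I, W J (s I) /\ near_prob x (g * s I)%g r.
Proof.
move=> xJ r0.
have : nbhs (g^-1 * x)%g [set u | near_prob x (g * u)%g r].
  apply: (@mulg_l_continuous G g (g^-1 * x)%g [set y | near_prob x y r]).
  by rewrite mulVKg; exact: near_prob_nbhs.
rewrite nbhsE => -[U [oU Ux] UN].
have [t [Wt Ut]] := xJ U (open_nbhs_nbhs (conj oU Ux)).
have [K [Kt KU]] := Wnbhs (W_subT Wt) (open_nbhs_nbhs (conj oU Ut)).
exists (K ++ J).
have : W (K ++ J) (s (K ++ J)) by apply: sample_pointP; rewrite Wcat; split; [exact: Kt|exact: Wt].
by rewrite Wcat => -[/KU/UN].
Qed.

(** For fixed [g], sampled values approach [Y (dG i)] in probability, so almost surely they do not
    all stay [n.+1%:R^-1] away. There are countably many triples [(i, J, n)], and Fubini exchanges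
    [g] and [o]. *)
Lemma closure_translate : \forall o \ae P, exists2 N, mus N = 0 &
  forall g, ~ N g -> forall i J n, closed_translate (dG i) J g ->
    exists I, W J (s I) /\ (rho (Y (dG i) o) (f o (g * s I)%g) < n.+1%:R^-1)%R.
Proof.
pose BE (q : nat * seq nat * nat) : set (Omega * caratheodory_type mus) :=
  (setT `*` closed_translate (dG q.1.1) q.1.2) `&` \bigcap_I
  (if pselect (W q.1.2 (s I)) then
   ~` [set w | (rho (Y (dG q.1.1) w.1) (f w.1 (w.2 * s I)%g) < q.2.+1%:R^-1)%R] else setT).
have mBE q : measurable (BE q).
  apply: measurableI.
    by apply: measurableX => //; exact: caratheodory_closed_translate.
  apply: bigcap_countType_measurable => I; case: pselect => //= _; apply: measurableC.
  apply: (measurable_rho_lt hrho sX); last exact: measurable_fun_rtranslate.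
  exact: measurableT_comp (mY _) measurable_fst.
have BE0 q g : P (ysection (BE q) g) = 0.
  move: q => [[i J] n].
  have [cg|ncg] := pselect (closed_translate (dG i) J g); last first.
    rewrite (_ : ysection _ _ = set0) ?measure0//.
    by apply/seteqP; split => o //; rewrite /ysection /= inE => -[[_ /=]].
  apply/eqP; rewrite eq_le measure_ge0 andbT; apply/lee_addgt0Pr => e e0; rewrite add0e.
  (* One radius controls both the probability, by [e], and the distance, by [n.+1%:R^-1]. *)
  have r0 : (0 < Num.min e n.+1%:R^-1)%R by rewrite lt_min e0/=.
  have [I [WI nI]] := closed_translate_near cg r0.
  apply: (@le_trans _ _ (P (~` near_event (dG i) (g * s I)%g n.+1%:R^-1))).
    have -> : P (~` near_event (dG i) (g * s I)%g n.+1%:R^-1) =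
        P (~` [set o | (rho (Y (dG i) o) (f o (g * s I)%g) < n.+1%:R^-1)%R]).
      have mfI : measurable_fun setT ((fun o => f o (g * s I)%g) : Omega -> borel X).
        exact: (measurable_fun_pair1 (g : caratheodory_type mus) (measurable_fun_rtranslate (s I))).
      apply: ae_measure_eq.
      - by apply: measurableC; exact: measurable_near_event.
      - by apply: measurableC; exact: (measurable_rho_lt hrho sX).
      by have := fY (g * s I)%g; apply: filterS => o /= ->.
    apply: le_measure; rewrite ?inE.
    - exact: measurable_ysection.
    - apply: measurableC; apply: (measurable_rho_lt hrho sX) => //.
      exact: (measurable_fun_pair1 (g : caratheodory_type mus) (measurable_fun_rtranslate (s I))).
    - move=> o; rewrite /ysection /= inE => -[_ /(_ I Logic.I)] /=.
      by case: pselect.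
  have le : P (~` near_event (dG i) (g * s I)%g n.+1%:R^-1) <=
      P (~` near_event (dG i) (g * s I)%g (Num.min e n.+1%:R^-1)%R).
    apply: le_measure; rewrite ?inE; [by apply: measurableC; exact: measurable_near_event..|].
    by apply: subsetC => o; rewrite /near_event /= lt_min => /andP[].
  by apply: (le_trans le); apply: (le_trans (ltW nI)); rewrite lee_fin ge_min lexx.
have sfP : sigma_finite setT P by exact: sigma_finiteT.
have sfm := completed_measure_extension_sigma_finite (haar_sigma_finite lcG polG haar).
have : \forall o \ae P, forall q, mus (xsection (BE q) o) = 0.
  by apply: ae_countType => q; exact: (fubini_null sfP sfm (mBE q) (BE0 q)).
apply: filterS => o o0; exists (\bigcup_q xsection (BE q) o).
  exact: (@outer_null_bigcup (borel G)).
move=> g ng i J n cg; apply: contrapT => /forallNP h; apply: ng.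
exists (i, J, n) => //; rewrite /xsection /= inE; split => // I _ /=.
by case: pselect => //= WI rI; exact: (h I).
Qed.

(** * Limits along a dense sequence and the continuous modification *)

Definition limit_at (o : Omega) (x : G) (l : X) := forall e : R, (0 < e)%R ->
  \forall y \near x, forall i, y = dG i -> (rho (Y y o) l < e)%R.

(** The set is [x * T^-1], and inversion and right translation preserve null sets. *)
Lemma nonnull_translate_inv x : 0 < mus [set g | T (g^-1 * x)%g].
Proof.
rewrite lt0e outer_measure_ge0 andbT; apply/eqP => h.
suff : mus T = 0 by move: T0 => /[swap] ->; rewrite ltxx.
have := outer_null_rtranslate lcG polG haar x^-1%g (outer_null_inv lcG polG haar h).
apply: etrans; congr (mus _); apply/seteqP; split => g /=; by rewrite invgK mulgVK.
Qed.

Lemma limit_exists : \forall o \ae P, forall x, exists l, limit_at o x l.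
Proof.
apply: filterS2 good_translate closure_translate => o [N1 N10 hN1] [N2 N20 hN2] x.
pose Gam (q : seq nat * nat * nat) : set G := [set g | forall I, W q.1.1 (s I) ->
  (rho (xs q.1.2) (f o (g * s I)%g) < q.2.+1%:R^-1)%R].
have mGam q : mus.-caratheodory (Gam q).
  rewrite (_ : Gam q = \bigcap_I (if pselect (W q.1.1 (s I)) then
      (fun g => f o (g * s I)%g) @^-1` [set y | (rho (xs q.1.2) y < q.2.+1%:R^-1)%R]
      else setT)); last first.
    apply/seteqP; split => g h I.
      by move=> _; case: pselect => //= WI; exact: h.
    by have := h I Logic.I; case: pselect.
  apply: (@bigcap_countType_measurable _ (caratheodory_type mus)) => I.
  case: pselect => //= _.
  apply: (@borel_preimage_open _ _ (caratheodory_type mus)); last exact: open_rho.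
  exact: (measurable_fun_pair2 o (measurable_fun_rtranslate (s I))).
pose A q := closed_translate x q.1.1 `&` Gam q.
have cA q : mus.-caratheodory (A q).
  by apply: caratheodory_measurable_setI => //; exact: caratheodory_closed_translate.
(* The null sets among the countably many [A q] are avoided, so that any [A q] containing the chosen
   [g] is non-null. *)
pose A0 q := if pselect (mus (A q) = 0) then A q else set0.
have A00 : mus (\bigcup_q A0 q) = 0.
  apply: (@outer_null_bigcup (borel G)) => q; rewrite /A0; case: pselect => //= _; exact: mu_ext0.
have Nnull : mus (N1 `|` N2 `|` \bigcup_q A0 q) = 0.
  by apply: (@outer_nullU (borel G)) => //; apply: (@outer_nullU (borel G)).
have [g [Tg Ng]] : exists g, T (g^-1 * x)%g /\ ~ (N1 `|` N2 `|` \bigcup_q A0 q) g.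
  apply: contrapT => /forallNP h.
  suff h0 : mus [set g | T (g^-1 * x)%g] = 0.
    by have := nonnull_translate_inv x; rewrite h0 ltxx.
  apply: (@outer_nullS (borel G) _ _ _ _ _ Nnull) => g Tg.
  by apply: contrapT => ng; exact: (h g).
have [l hl] := hN1 g (fun h => Ng (or_introl (or_introl h))) _ Tg.
exists l => e e0.
have [n ne] : exists n : nat, (n.+1%:R^-1 < e / 3 :> R)%R.
  exists (Num.truncn (e / 3)^-1); rewrite invf_plt ?posrE ?divr_gt0//.
  exact: truncnS_gt.
(* Sampled values and [xs k] are each within half of [n.+1%:R^-1] of [l], hence within [n.+1%:R^-1]
   of each other. *)
have c0 : (0 < n.+1%:R^-1 / 2 :> R)%R by rewrite divr_gt0.
have [J [WJ hJ]] := hl _ c0.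
have [k hk] := hxs l c0.
have Ag : A (J, k, n) g.
  split; first exact: subset_closure.
  move=> I WI /=; apply: (le_lt_trans (rho_tri hrho _ l _)).
  rewrite (rho_sym hrho (xs k) l) (rho_sym hrho l (f _ _)) [ltRHS]splitr ltrD//.
  exact: hJ.
have Apos : 0 < mus (A (J, k, n)).
  rewrite lt0e outer_measure_ge0 andbT; apply/eqP => h0; apply: Ng; right.
  by exists (J, k, n) => //; rewrite /A0; case: pselect.
have near1 := steinhaus lcG polG haar (cA _) Apos.
(* Here [v = y * x^-1]: if [x] lies in [v^-1 * h] times the closure of [W J], then [y] lies in [h]
   times that closure. *)
have : \forall y \near x, 0 < mus (A (J, k, n) `&` [set h | A (J, k, n) ((y * x^-1)^-1 * h)%g]).
  apply: (@mulg_r_continuous G x^-1%g x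
    [set v | 0 < mus (A (J, k, n) `&` [set h | A (J, k, n) (v^-1 * h)%g])]).
  by rewrite mulgV.
apply: filterS => y ypos i yi.
have [h [Ah Avh N2h]] : exists h, [/\ A (J, k, n) h,
    A (J, k, n) ((y * x^-1)^-1 * h)%g & ~ N2 h].
  apply: contrapT => /forallNP nh.
  suff h0 : mus (A (J, k, n) `&` [set h | A (J, k, n) ((y * x^-1)^-1 * h)%g]) = 0.
    by rewrite h0 ltxx in ypos.
  apply: (@outer_nullS (borel G) _ _ _ _ _ N20) => h [Ah Avh].
  by apply: contrapT => nN2; apply: (nh h).
have cy : closed_translate (dG i) J h.
  have [+ _] := Avh; rewrite /closed_translate /= -yi.
  by rewrite !invgM !invgK -!mulgA mulVg mulg1.
have [I [WI rI]] := hN2 h N2h i J n cy.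
have [_ /(_ I WI) /= rk] := Ah.
have t1 := rho_tri hrho (Y y o) (f o (h * s I)%g) l.
have t2 := rho_tri hrho (f o (h * s I)%g) (xs k) l.
rewrite (rho_sym hrho _ (xs k)) (rho_sym hrho (xs k) l) in t2.
rewrite -yi in rI.
move: ne hk rI rk t1 t2; set c := (n.+1%:R^-1)%R.
lra.
Qed.

Lemma dG_near (x : G) (U : set G) : nbhs x U -> exists i, U (dG i).
Proof.
rewrite nbhsE => -[V [oV Vx] VU].
by have [i Vi] := hdG oV (ex_intro _ x Vx); exists i; exact: VU.
Qed.

Lemma sample_continuous_of_natural : sample_continuous P Y.
Proof.
pose xi o x := xget point [set l | limit_at o x l].
have xiP : \forall o \ae P, forall x, limit_at o x (xi o x).
  apply: filterS limit_exists => o h x.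
  by have [l hl] := h x; exact: (xgetI (P := [set l | limit_at o x l]) point hl).
exists xi; last first.
  apply: filterS xiP => o h x; apply: (metric_continuous hrho) => e e0.
  have e2 : (0 < e / 2)%R by rewrite divr_gt0.
  (* A single [dG i] close to [y] has its value within [e / 2] of both limits. *)
  have := nbhs_interior (h x _ e2); apply: filterS => y hy.
  have [i [Ui Vi]] := dG_near (filterI hy (h y _ e2)).
  have := rho_tri hrho (xi o x) (Y (dG i) o) (xi o y).
  have := Ui i erefl; have := Vi i erefl.
  rewrite (rho_sym hrho (xi o x) (Y (dG i) o)).
  lra.
move=> x.
have [rG hrG] : exists r : G -> G -> R, metric_for r.
  by apply: metrizable_metric_for; have [_ [m mm _]] := polG; exists m.
(* These radii are summable, so Borel-Cantelli gives almost sure convergence of [Y (dG (i n))] to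
   [Y x]. *)
pose r n : R := (1 / (2 ^ n.+1)%:R)%R.
have r0 n : (0 < r n)%R by rewrite divr_gt0// ltr0n expn_gt0.
have r_small (e : R) : (0 < e)%R -> exists M, forall n, (M <= n)%N -> (r n < e)%R.
  move=> e0; exists (Num.truncn e^-1) => n Mn.
  rewrite /r div1r invf_plt ?posrE ?ltr0n ?expn_gt0//.
  apply: (lt_le_trans (truncnS_gt _)); rewrite ler_nat.
  by apply: (leq_trans _ (ltnW (ltn_expl _ _))).
have /choice[i hi] n : exists i, (rG x (dG i) < r n)%R /\ near_prob x (dG i) (r n).
  by apply: (dG_near (filterI (nbhs_rho hrG x (r0 n)) (near_prob_nbhs x (r0 n)))).
pose B n := ~` near_event x (dG (i n)) (r n).
have mB n : measurable (B n) by apply: measurableC; exact: measurable_near_event.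
have B0 : P (lim_sup_set B) = 0.
  apply: lim_sup_set_cvg0 => //.
  apply: (@le_lt_trans _ _ 1%:E); last exact: ltry.
  apply: le_trans (epsilon_trick0 xpredT (ler01)).
  by apply: lee_nneseries => // n _; have [_ /ltW] := hi n.
have aeB : \forall o \ae P, ~ lim_sup_set B o.
  exists (lim_sup_set B); split => //.
    by apply: bigcapT_measurable => n; exact: bigcup_measurable.
  by move=> o /contrapT.
apply: filterS2 xiP aeB => o hxi nB; apply: (rho_sep hrho); apply/eqP/negPn/negP => d0.
(* For large [n] the value at [dG (i n)] is within half the supposed distance of both [xi o x] and
   [Y x o]. *)
have {}d0 : (0 < rho (xi o x) (Y x o) / 2)%R by rewrite divr_gt0// lt0r d0 (rho_ge0 hrho).
have [M hM] : exists M, forall n, (M <= n)%N -> near_event x (dG (i n)) (r n) o.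
  move: nB => /existsNP[M /not_implyP[_ hM]]; exists M => n Mn.
  by apply: contrapT => h; apply: hM; exists n.
have [e e0 he] := (rho_nbhs hrG x _).1 (hxi x _ d0).
have [M1 hM1] := r_small _ e0; have [M2 hM2] := r_small _ d0.
pose n := maxn M (maxn M1 M2).
have a1 := hM n (leq_maxl _ _).
have a2 := hM2 n (leq_trans (leq_maxr _ _) (leq_maxr _ _)).
have a3 : (rG x (dG (i n)) < e)%R.
  have [h _] := hi n; apply: (lt_trans h); apply: hM1.
  by rewrite /n (leq_trans _ (leq_maxr _ _))// leq_maxl.
have a4 := he _ a3 (i n) erefl.
have := rho_tri hrho (xi o x) (Y (dG (i n)) o) (Y x o).
rewrite (rho_sym hrho (xi o x) (Y (dG (i n)) o)) (rho_sym hrho (Y (dG (i n)) o) (Y x o)).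
move: a1 a2 a4; rewrite /near_event /=; lra.
Qed.

End natural_modification_nonnull.

Unset Implicit Arguments.

Theorem theorem11 (R : realType)
    (G : topologicalGroupType) (mu : {measure set (borel G) -> \bar R})
    (X : ptopologicalType)
    (d : measure_display) (Omega : measurableType d) (P : probability Omega R)
    (Y : G -> Omega -> X) :
  locally_compact [set: G] -> polish R G -> left_haar mu ->
  separable X -> metrizable R X ->
  standard P ->
  stochastic_field Y -> haar_measurable_field P mu Y -> stationary P Y ->
  sample_continuous P Y \/
  (forall T : set G, 0 < (mu^*)%mu T ->
     ~ has_natural_modification P (restrict_field (T := T) Y)).
Proof.
move=> lcG polG haar sX metX stdP mY [f fY mf] statY.
(* A natural modification over a single non-null set already yields sample continuity, so failure of
   the latter excludes them all. *)
have [|nsc] := pselect (sample_continuous P Y); first by left.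
right=> T T0 natT; apply: nsc.
have [rho hrho] := metrizable_metric_for metX.
have [z [W [W0 Wcat Wnbhs zY zW]]] := natural_family hrho polG natT.
have [xs hxs] := rho_dense_sequence hrho sX.
have [dG hdG] := dense_sequence polG.1.
exact: (@sample_continuous_of_natural R d Omega P X G mu rho hrho sX lcG polG
  haar Y mY statY f fY mf T z W T0 W0 Wcat Wnbhs zY zW stdP xs dG hxs hdG).
Qed.
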